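(* Let $A$ and $B$ be bounded subsets of $\mathbb{R}$ with $D_B\le D_A$, where $D_A=\mathrm{diam}(A)$, $D_B=\mathrm{diam}(B)$, and suppose $$\lambda(A+B)=D_B+\lambda(A)<\lambda(A)+2\lambda(B).$$ Put $A'=A-\inf(A)$ and $B'=B-\inf(B)$. Then there exist positive real numbers $b,c$ with $b,c\le D_B$ such that the interval $I=(b,D_A-c)$ has length at least $\lambda(A)+\lambda(B)-D_B$ and, writing $A_1=A'\cap[0,b]$ and $A_2=D_A-(A'\cap[D_A-c,D_A])$, the following hold up to sets of Lebesgue measure $0$: \begin{itemize} \item $A'\cap[0,b]=(A'+B')\cap[0,b]$; \item $(A'+B')\cap[D_A+D_B-c,\,D_A+D_B]=D_A+D_B-A_2$; \item $I\subset A'$; \item $(b,D_A+D_B-c)\subset A'+B'$; \item $A'=A_1\cup I\cup(D_A-A_2)$ and $A'+B'=A_1\cup(b,D_A+D_B-c)\cup(D_A+D_B-A_2)$. \end{itemize} Furthermore, up to sets of measure $0$, $B'$ is a disjoint union $B'=B_1\cup B_I\cup(D_B-B_2)$ of three sets such that \begin{itemize} \item $B_1\subset A_1$, $B_2\subset A_2$, $B_I\subset(b,D_B-c)$; \item $\lambda(B_1\cap[0,x])\le x^2/c_1$ for all $0< x\le c_1$, where $c_1=\sup\{x : \lambda(A'\cap[0,x])\le \tfrac12 x\}$; \item $\lambda(B_2\cap[0,x])\le x^2/c_2$ for all $0< x\le c_2$, where $c_2=\sup\{x : \lambda(A'\cap(D_A-x,D_A))\le \tfrac12 x\}$. \end{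itemize}
   Context: $\lambda$ denotes the inner Lebesgue measure on $\mathbb{R}$; for a bounded set $S\subset\mathbb{R}$, $\mathrm{diam}(S)=\sup(S)-\inf(S)$. For $t\in\mathbb{R}$ and $X\subset\mathbb{R}$, $t-X=\{t-x:x\in X\}$ and $t+X=\{t+x:x\in X\}$. The first two bulleted items are what the paper phrases as ''$A_1$ is $B'$-stable'' and ''$A_2$ is $B'$-stable'' (the latter understood after the reflection $x\mapsto D_A+D_B-x$).
   Formalization: b, c are only nonnegative, and positive when λ(B)<D_B (A=B=[0,1] forces b=c=0); the suprema defining c_1, c_2 run over 0≤x≤D_A (otherwise infinite); ''up to measure 0'' means that the differences have inner measure λ equal to 0. *)

(* Defs.v *)
From HB Require Import structures.
From mathcomp Require Import all_boot all_order all_algebra.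
From mathcomp Require Import all_classical all_reals all_analysis.
Set Implicit Arguments.
Unset Strict Implicit.
Unset Printing Implicit Defensive.
Import Order.TTheory GRing.Theory Num.Theory.
Import numFieldNormedType.Exports.
Local Open Scope classical_set_scope.
Local Open Scope ring_scope.

Definition inner_lebesgue (R : realType) (S : set R) : \bar R :=
  ereal_sup [set (@lebesgue_measure R) K | K in [set K | compact K /\ K `<=` S]].

Definition diam (R : realType) (S : set R) : R := sup S - inf S.

Definition sumset (R : realType) (X Y : set R) : set R :=
  [set x + y | x in X & y in Y].

Definition translate (R : realType) (t : R) (X : set R) : set R :=
  [set t + x | x in X].

Definition reflect_at (R : realType) (t : R) (X : set R) : set R :=
  [set t - x | x in X].

(* Null sets are those of inner measure 0. Outer measure would be the wrong
   notion here: even for measurable X and Y the sumset of X and Y need not be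
   measurable. Since inner null sets are not closed under unions, the two
   differences in null_eq are bounded separately and not through the symmetric
   difference; for measurable sets this is the usual equality up to a null set. *)
Definition null_sub (R : realType) (X Y : set R) : Prop :=
  inner_lebesgue (X `\` Y) = 0%E.

Definition null_eq (R : realType) (X Y : set R) : Prop :=
  null_sub X Y /\ null_sub Y X.

(* The constants c_1 and c_2 for a set X contained in [0, D]. The range of x
   must be limited to [0, D]: every x >= 2 * inner_lebesgue X satisfies the
   inequality, so that the supremum over all reals would be infinite. *)
Definition left_half_radius (R : realType) (D : R) (X : set R) : R :=
  sup [set x : R | 0 <= x <= D /\
    (inner_lebesgue (X `&` `[0%R, x]) <= (x / 2)%:E)%E].

Definition right_half_radius (R : realType) (D : R) (X : set R) : R :=
  sup [set x : R | 0 <= x <= D /\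
    (inner_lebesgue (X `&` `](D - x)%R, D[) <= (x / 2)%:E)%E].

(* Main.v *)
(** Up to null sets, [A] and [B] may be replaced by sigma-compact subsets of full inner measure
    with their end points added: the sumset does not grow, because a compact set outside the
    sumset cannot have arbitrarily small translates inside it. Reduce [A + B] modulo [D_A]: the
    two parts overlap in a set containing [B], so Raikov's inequality on the circle (obtained
    from Cauchy-Davenport by discretization) gives [D_A + m(B) <= m(A) + D_B]; hence the
    complement [C] of [A] in [[0, D_A]] satisfies [m(C) < m(B)]. A hole [s] of [A + B] reflects
    [B] into [C]. Therefore the holes lie in [E] and [D_A + F] with [E] and [F] inside
    [[0, D_B]], the set [C] is [E] together with [F + D_A - D_B] up to a null set, and every
    element of [E] is below every element of [F]. One takes [b = sup E] and [c = D_B - inf F];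
    if one of the two vanishes, then there is room to increase it, because otherwise the other
    kind of holes would use up all the space, the measure of [B] on windows would be monotone,
    and the Lebesgue density theorem would make [B] full.

    For the quadratic bound, let [x] be in [B] with [m(B cap [0, x]) >= x^2 / c_1]. Raikov's
    inequality modulo [x] shows that the measure of [A] in the successive intervals of length
    [x] increases by [x^2 / c_1] at each step, so [A] would fill more than half of
    [[0, c_1]]. *)
Require Import Defs.
From HB Require Import structures.
From mathcomp Require Import all_boot all_order all_algebra.
From mathcomp Require Import all_classical all_reals all_analysis.
From mathcomp Require Import measurable_realfun ring lra zify.
Import Order.TTheory GRing.Theory Num.Theory.
Import numFieldNormedType.Exports.
Local Open Scope classical_set_scope.
Local Open Scope ring_scope.

Set Implicit Arguments.
Unset Strict Implicit.
Unset Printing Implicit Defensive.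

(** * Real-valued Lebesgue measure *)

Section RealMeasure.
Variable R : realType.
Implicit Types (X Y N : set R) (t u v w x e : R).

Local Notation mu := (@lebesgue_measure R).

Lemma translateE t X : translate t X = [set x | X (x - t)].
Proof.
apply/seteqP; split => x /=; first by case=> y Xy <-; rewrite addrC addKr.
by move=> Xx; exists (x - t) => //; rewrite addrC subrK.
Qed.

Lemma reflect_atE t X : reflect_at t X = [set x | X (t - x)].
Proof.
apply/seteqP; split => x /=; first by case=> y Xy <-; rewrite subKr.
by move=> Xx; exists (t - x) => //; rewrite subKr.
Qed.

Lemma measurable_translate t X : measurable X -> measurable (translate t X).
Proof.
move=> mX; rewrite translateE -[X in measurable X]setTI.
by apply: (_ : measurable_fun setT (fun x : R => x - t)) => //; exact: measurable_funB.
Qed.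

Lemma measurable_reflect_at t X : measurable X -> measurable (reflect_at t X).
Proof.
move=> mX; rewrite reflect_atE -[X in measurable X]setTI.
by apply: (_ : measurable_fun setT (fun x : R => t - x)) => //; exact: measurable_funB.
Qed.

Lemma lebesgue_measure_translate t X : measurable X -> mu (translate t X) = mu X.
Proof.
move=> mX; rewrite translateE -[LHS]/(pushforward mu ((fun x => x - t) : _ -> measurableTypeR R) X).
apply/esym/lebesgue_measure_unique => //=; first exact: measurable_funB.
move=> _ _ [[a b]] _ <-; rewrite /pushforward.
rewrite (_ : _ @^-1` _ = `]a + t, b + t]%classic); last first.
  by apply/seteqP; split => x /=; rewrite !in_itv/= ltrBrDr lerBlDr.
rewrite !lebesgue_measure_itv/= !lte_fin ltrD2r.
by case: ifP => // _; rewrite -!EFinB opprD addrACA subrr addr0.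
Qed.

Lemma lebesgue_measure_reflect_at t X : measurable X -> mu (reflect_at t X) = mu X.
Proof.
move=> mX; have mtX := @measurable_translate (- t) _ mX.
rewrite -[RHS](lebesgue_measure_translate (- t)) // -[RHS]lebesgue_measureN // /pushforward.
by congr (mu _); rewrite reflect_atE translateE; apply/seteqP; split => x /=; rewrite opprK addrC.
Qed.

Lemma negligible_translate t N : mu.-negligible N -> mu.-negligible (translate t N).
Proof.
move=> [M [mM M0 NM]]; exists (translate t M); split; first exact: measurable_translate.
  by rewrite lebesgue_measure_translate.
by rewrite !translateE => x /NM.
Qed.

Lemma negligible_reflect_at t N : mu.-negligible N -> mu.-negligible (reflect_at t N).
Proof.
move=> [M [mM M0 NM]]; exists (reflect_at t M); split; first exact: measurable_reflect_at.
  by rewrite lebesgue_measure_reflect_at.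
by rewrite !reflect_atE => x /NM.
Qed.

Lemma negligible_set1 x : mu.-negligible [set x].
Proof. by apply/negligibleP => //; exact: lebesgue_measure_set1. Qed.

Lemma negligible_subset0 N : N `<=` set0 -> mu.-negligible N.
Proof. by rewrite subset0 => ->; exact: negligible_set0. Qed.

Definition finmeas X : Prop := measurable X /\ (mu X < +oo)%E.

Lemma finmeas_sub X Y : measurable X -> finmeas Y -> X `<=` Y -> finmeas X.
Proof.
move=> mX [mY fY] XY; split => //; apply: le_lt_trans fY.
by apply: le_measure; rewrite ?inE.
Qed.

Lemma finmeasU X Y : finmeas X -> finmeas Y -> finmeas (X `|` Y).
Proof.
move=> [mX fX] [mY fY]; split; first exact: measurableU.
by apply: le_lt_trans (lte_add_pinfty fX fY); exact: measureU2.
Qed.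

Lemma finmeasIl X Y : finmeas X -> measurable Y -> finmeas (X `&` Y).
Proof. by move=> fX mY; apply: finmeas_sub (fX) _ => //; apply: measurableI; case: fX. Qed.

Lemma finmeasIr X Y : measurable X -> finmeas Y -> finmeas (X `&` Y).
Proof. by rewrite setIC => mX fY; exact: finmeasIl. Qed.

Lemma finmeasD X Y : finmeas X -> measurable Y -> finmeas (X `\` Y).
Proof. by move=> fX mY; rewrite setDE; apply: finmeasIl => //; exact: measurableC. Qed.

Lemma finmeas_translate t X : finmeas X -> finmeas (translate t X).
Proof.
by move=> [mX fX]; split; [exact: measurable_translate|rewrite lebesgue_measure_translate].
Qed.

Lemma finmeas_itv (a b : bool) u v : finmeas [set` Interval (BSide a u) (BSide b v)].
Proof.
split; first exact: measurable_itv.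
by rewrite lebesgue_measure_itv/=; case: ifP => _ //; rewrite -EFinB ltry.
Qed.

Lemma finmeas_compact X : compact X -> finmeas X.
Proof. by move=> cX; split; [exact: compact_measurable|exact: compact_finite_measure]. Qed.

Definition rmeas X : R := fine (mu X).

Lemma rmeasE X : finmeas X -> mu X = (rmeas X)%:E.
Proof. by move=> [mX fX]; rewrite fineK // ge0_fin_numE. Qed.

Lemma rmeas_ge0 X : 0 <= rmeas X.
Proof. exact: fine_ge0. Qed.

Lemma rmeas_translate t X : measurable X -> rmeas (translate t X) = rmeas X.
Proof. by move=> mX; rewrite /rmeas lebesgue_measure_translate. Qed.

Lemma rmeas_reflect_at t X : measurable X -> rmeas (reflect_at t X) = rmeas X.
Proof. by move=> mX; rewrite /rmeas lebesgue_measure_reflect_at. Qed.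

Lemma rmeas_itv (a b : bool) u v : u <= v ->
  rmeas [set` Interval (BSide a u) (BSide b v)] = v - u.
Proof.
move=> uv; rewrite /rmeas lebesgue_measure_itv /= lte_fin; case: ltP => // vu.
by rewrite (@le_anti _ _ u v) ?subrr ?uv.
Qed.

Lemma le_rmeas_ae X Y : measurable X -> finmeas Y -> mu.-negligible (X `\` Y) ->
  rmeas X <= rmeas Y.
Proof.
move=> mX fY XY; have [mY _] := fY; have mXY := measurableD mX mY.
have XY0 : mu (X `\` Y) = 0%E by apply/negligibleP.
have XYE : mu X = mu (X `&` Y).
  by rewrite -[RHS]add0e -XY0; exact: measureDI.
rewrite /rmeas XYE -lee_fin -!rmeasE //; last by exact: finmeasIr.
by apply: le_measure; rewrite ?inE //; exact: measurableI.
Qed.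

Lemma le_rmeas X Y : measurable X -> finmeas Y -> X `<=` Y -> rmeas X <= rmeas Y.
Proof.
move=> mX fY XY; apply: le_rmeas_ae => //; apply: negligible_subset0.
by rewrite subset0 setD_eq0.
Qed.

Lemma eq_rmeas_ae X Y : finmeas X -> finmeas Y -> mu.-negligible (X `\` Y) ->
  mu.-negligible (Y `\` X) -> rmeas X = rmeas Y.
Proof.
by move=> fX fY XY YX; apply: le_anti; rewrite !le_rmeas_ae //; [case: fY|case: fX].
Qed.

Lemma rmeas_negligible X : finmeas X -> mu.-negligible X <-> rmeas X = 0.
Proof.
move=> fX; have nullP : mu.-negligible X <-> mu X = 0%E.
  by apply: negligibleP; case: fX.
by rewrite nullP rmeasE //; split=> [X0|->] //; exact: EFin_inj X0.
Qed.

Lemma rmeasID X Y : finmeas X -> measurable Y ->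
  rmeas X = rmeas (X `&` Y) + rmeas (X `\` Y).
Proof.
move=> fX mY; apply: EFin_inj; rewrite EFinD -!rmeasE //; first last.
- exact: finmeasIl.
- exact: finmeasD.
by rewrite addeC; apply: measureDI => //; case: fX.
Qed.

Lemma rmeasU X Y : finmeas X -> finmeas Y -> X `&` Y `<=` set0 ->
  rmeas (X `|` Y) = rmeas X + rmeas Y.
Proof.
move=> fX fY XY; rewrite (@rmeasID (X `|` Y) X); [|exact: finmeasU|by case: fX].
have -> : (X `|` Y) `&` X = X by rewrite setIC setIUr setIid; apply/setUidPl => x [].
by rewrite setDUl setDv set0U setDidl // setIC; apply/seteqP; split.
Qed.

Lemma rmeas_inner X e : finmeas X -> 0 < e ->
  exists K : set R, [/\ compact K, K `<=` X & rmeas X < rmeas K + e].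
Proof.
move=> fX e0; have [mX lX] := fX.
have [K [cK KX KXe]] := lebesgue_regularity_inner mX lX e0.
have mK : measurable K := compact_measurable cK.
exists K; split => //; rewrite (@rmeasID X K) // setIidr // ltrD2l.
by rewrite -lte_fin -rmeasE //; exact: finmeasD.
Qed.

Lemma rmeas_outer X e : finmeas X -> 0 < e ->
  exists U : set R, [/\ open U, X `<=` U, finmeas (U `\` X) & rmeas (U `\` X) < e].
Proof.
move=> fX e0; have [mX lX] := fX.
have [U [oU XU UX]] := lebesgue_regularity_outer mX lX e0.
have fU : finmeas (U `\` X).
  split; first by apply: measurableD => //; exact: open_measurable.
  by apply: lt_trans UX _; rewrite ltry.
by exists U; split => //; rewrite -lte_fin -rmeasE.
Qed.

Definition mass X u v : R := rmeas (X `&` `[u, v]).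

Lemma finmeas_mass X u v : measurable X -> finmeas (X `&` `[u, v]).
Proof. by move=> mX; apply: finmeasIr => //; exact: finmeas_itv. Qed.

Lemma mass_ge0 X u v : 0 <= mass X u v.
Proof. exact: rmeas_ge0. Qed.

Lemma le_mass_ae N X Y u v : measurable X -> measurable Y -> mu.-negligible N ->
  (forall x, u <= x <= v -> X x -> Y x \/ N x) -> mass X u v <= mass Y u v.
Proof.
move=> mX mY N0 XYN; apply: le_rmeas_ae; [|exact: finmeas_mass|].
  by apply: measurableI.
apply: negligibleS N0 => x [[Xx xuv] nY].
by case: (XYN x xuv Xx) => // Yx; case: nY.
Qed.

Lemma le_mass X Y u v : measurable X -> measurable Y ->
  (forall x, u <= x <= v -> X x -> Y x) -> mass X u v <= mass Y u v.
Proof.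
move=> mX mY XY; apply: (@le_mass_ae set0) => //; first exact: negligible_set0.
by move=> x xuv /(XY x xuv); left.
Qed.

Lemma rmeasI_itv_oo X u v : measurable X -> rmeas (X `&` `]u, v[) = mass X u v.
Proof.
move=> mX; apply: eq_rmeas_ae; [|exact: finmeas_mass| |].
- by apply: finmeasIr => //; exact: finmeas_itv.
- apply: negligible_subset0 => x [[Xx /=] + nx]; rewrite in_itv /= => xuv.
  by apply: nx; split => //=; rewrite in_itv /=; lra.
apply: negligibleS (negligibleU (negligible_set1 u) (negligible_set1 v)).
move=> x [[Xx /=]]; rewrite in_itv /= => xuv nx.
have [->|xu] := eqVneq x u; first by left.
have [->|xv] := eqVneq x v; first by right.
by case: nx; split => //=; rewrite in_itv /= !lt_neqAle eq_sym xu xv.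
Qed.

Lemma mass_eq0 X u v : measurable X -> mu.-negligible (X `&` `]u, v[) -> mass X u v = 0.
Proof.
move=> mX Xuv; rewrite -rmeasI_itv_oo //; apply/rmeas_negligible => //.
by apply: finmeasIr => //; exact: finmeas_itv.
Qed.

Lemma mass_gt0_ex X u v : measurable X -> 0 < mass X u v -> exists2 x, X x & u < x < v.
Proof.
move=> mX X0; apply: contrapT => nX; move: X0; rewrite mass_eq0 ?ltxx //.
apply: negligible_subset0 => x [Xx /=]; rewrite in_itv /= => xuv.
by case: nX; exists x.
Qed.

Lemma mass_le X u v : measurable X -> u <= v -> mass X u v <= v - u.
Proof.
move=> mX uv; rewrite -(rmeas_itv true false uv); apply: le_rmeas => //.
  exact: measurableI.
exact: finmeas_itv.
Qed.

Lemma mass_degenerate X u v : measurable X -> v <= u -> mass X u v = 0.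
Proof.
move=> mX vu; apply/rmeas_negligible; first exact: finmeas_mass.
apply: negligibleS (negligible_set1 u) => x [_] /=; rewrite in_itv /= => xuv.
by apply: le_anti; lra.
Qed.

Lemma massD X u v w : measurable X -> u <= v <= w -> mass X u w = mass X u v + mass X v w.
Proof.
move=> mX uvw; rewrite /mass (@rmeasID _ `[u, v]%classic); [|exact: finmeas_mass|by []].
congr (_ + _).
  congr rmeas; apply/seteqP; split => x /=; rewrite !in_itv /=; first by case=> -[].
  by case=> Xx xI; split => //; split => //; lra.
apply: eq_rmeas_ae; [by apply: finmeasD => //; exact: finmeas_mass|exact: finmeas_mass|..].
  apply: negligible_subset0 => x [[[Xx /=] + xI]]; rewrite !in_itv /= => xuw nv.
  by apply: nv; split => //; move/negP: xI; rewrite in_itv /=; lra.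
apply: negligibleS (negligible_set1 v) => x [[Xx /=]]; rewrite !in_itv /= => xvw nx.
have [//|xv] := eqVneq x v; case: nx; split; first by split => //; lra.
by move=> xuv; move/eqP: xv; apply; apply: le_anti; lra.
Qed.

Lemma mass_sub_itv X u v u' v' : measurable X -> u' <= u -> v <= v' ->
  mass X u v <= mass X u' v'.
Proof.
move=> mX uu vv; apply: le_rmeas; [by apply: measurableI|exact: finmeas_mass|].
by move=> x [Xx /=]; rewrite in_itv /= => xuv; split => //=; rewrite in_itv /=; lra.
Qed.

Lemma mass_le_trim_left X u v w : measurable X -> u <= v -> mass X u w <= v - u + mass X v w.
Proof.
move=> mX uv; have [vw|wv] := leP v w.
  by rewrite (@massD X u v w) ?uv // lerD2r mass_le.
have := @mass_sub_itv X u w u v mX (lexx u) (ltW wv); have := mass_le mX uv.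
by have := mass_ge0 X v w; lra.
Qed.

Lemma mass_le_trim_right X u v w : measurable X -> v <= w -> mass X u w <= mass X u v + (w - v).
Proof.
move=> mX vw; have [uv|vu] := leP u v.
  by rewrite (@massD X u v w) ?uv // lerD2l mass_le.
have := @mass_sub_itv X u w v w mX (ltW vu) (lexx w); have := mass_le mX vw.
by have := mass_ge0 X u v; lra.
Qed.

Lemma mass_translate t X u v : measurable X ->
  mass (translate t X) u v = mass X (u - t) (v - t).
Proof.
move=> mX; rewrite /mass -[RHS](rmeas_translate t); last exact: measurableI.
congr rmeas; rewrite !translateE; apply/seteqP; split => x /=; rewrite !in_itv /=;
  by case=> Xx xI; split => //; lra.
Qed.

Lemma mass_reflect_at t X u v : measurable X ->
  mass (reflect_at t X) u v = mass X (t - v) (t - u).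
Proof.
move=> mX; rewrite /mass -[RHS](rmeas_reflect_at t); last exact: measurableI.
congr rmeas; rewrite !reflect_atE; apply/seteqP; split => x /=; rewrite !in_itv /=;
  by case=> Xx xI; split => //; lra.
Qed.

Lemma mass_whole X u v : X `<=` `[u, v] -> mass X u v = rmeas X.
Proof. by rewrite /mass => /setIidl->. Qed.

Lemma mass_setC X u v : measurable X -> u <= v -> mass (~` X) u v = (v - u) - mass X u v.
Proof.
move=> mX uv; have fI := finmeas_itv true false u v.
rewrite -(rmeas_itv true false uv) (rmeasID fI mX) setDE /mass.
by rewrite (setIC X) (setIC (~` X)); lra.
Qed.

Lemma massUI X Y u v : measurable X -> measurable Y ->
  mass (X `|` Y) u v + mass (X `&` Y) u v = mass X u v + mass Y u v.
Proof.
move=> mX mY; have fX := finmeas_mass u v mX; have fY := finmeas_mass u v mY.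
rewrite /mass setIUl setIIl (@rmeasID (_ `|` _) (X `&` `[u, v])); [|exact: finmeasU|by case: fX].
have -> : (X `&` `[u, v] `|` Y `&` `[u, v]) `&` (X `&` `[u, v]) = X `&` `[u, v] by rewrite setUK.
rewrite setDUl setDv set0U (rmeasID fY (proj1 fX)) (setIC (Y `&` _)); lra.
Qed.

Lemma massU_le X Y u v : measurable X -> measurable Y ->
  mass (X `|` Y) u v <= mass X u v + mass Y u v.
Proof. by move=> mX mY; rewrite -massUI // lerDl mass_ge0. Qed.

Lemma mass_le_rmeas X u v : finmeas X -> mass X u v <= rmeas X.
Proof. by move=> fX; apply: le_rmeas => //; apply: measurableI => //; case: fX. Qed.

Lemma mass_full X u v : u <= v -> (forall x, u <= x <= v -> X x) -> mass X u v = v - u.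
Proof.
by move=> uv Xuv; rewrite /mass (setIidr (_ : `[u, v] `<=` X)) ?rmeas_itv.
Qed.

End RealMeasure.

(* The goals are matched syntactically: unification would unfold a translate to an image. *)
Ltac measurability := repeat first
  [ assumption
  | match goal with
    | H : finmeas ?X |- measurable ?X => exact: H.1
    | H : finmeas ?X |- finmeas (?X `&` _) => apply: finmeasIl
    end
  | lazymatch goal with
    | |- measurable [set` _] => exact: measurable_itv
    | |- measurable [set _] => exact: measurable_set1
    | |- measurable (_ `&` _) => apply: measurableI
    | |- measurable (_ `|` _) => apply: measurableU
    | |- measurable (_ `\` _) => apply: measurableD
    | |- measurable (~` _) => apply: measurableC
    | |- measurable (translate _ _) => apply: measurable_translate
    | |- measurable (reflect_at _ _) => apply: measurable_reflect_at
    | |- finmeas [set` _] => exact: finmeas_itv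
    | |- finmeas (_ `&` _) => apply: finmeasIr
    | |- finmeas (_ `|` _) => apply: finmeasU
    | |- finmeas (_ `\` _) => apply: finmeasD
    | |- finmeas (translate _ _) => apply: finmeas_translate
    end ].

(** * Raikov's inequality on the circle *)

Local Notation "A :+: B" := [set (x + y)%R | x in A, y in B]%SET (at level 52, left associativity).

Lemma dyson_transform (G : finZmodType) (A B : {set G}) (a b0 b1 : G) :
  b0 \in B -> b1 \in B -> a \in A -> b1 + (a - b0) \notin A ->
  exists A' B' : {set G}, [/\ (#|A'| + #|B'| = #|A| + #|B|)%N, A \subset A',
    (0 < #|B'| < #|B|)%N & A' :+: B' \subset A :+: B]%SET.
Proof.
move=> Bb0 Bb1 Aa nA; pose e := a - b0; pose B' := [set b in B | b + e \in A]%SET.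
have B'B : B' \subset B by apply/fintype.subsetP => x; rewrite inE => /andP[].
have disj : A :&: [set b + e | b in B :\: B'] = finset.set0.
  apply/finset.setP => x; rewrite !inE; apply/negbTE/andP => -[Ax /imsetP[b]].
  by rewrite !inE => /andP[/nandP[/negP//|/negP nb] bB] xE; apply: nb; rewrite -xE.
exists (A :|: [set b + e | b in B :\: B'])%SET, B'; split.
- rewrite cardsU disj cards0 subn0 card_imset; last exact: addIr.
  rewrite (cardsDS B'B).
  by have := subset_leq_card B'B; lia.
- exact: finset.subsetUl.
- apply/andP; split; first by apply/card_gt0P; exists b0; rewrite inE Bb0 addrC subrK.
  by apply: proper_card; apply/properP; split => //; exists b1; rewrite // inE Bb1.
apply/fintype.subsetP => _ /imset2P[x y + + ->]; rewrite !inE => xA' /andP[By Ay].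
case/orP: xA' => [Ax|/imsetP[b]]; first exact: imset2_f.
by rewrite !inE => /andP[_ bB] ->; rewrite -addrA (addrC b) (addrC e); exact: imset2_f.
Qed.

Lemma Fp_set_translation_stable (p : nat) (A : {set 'F_p}) (a d : 'F_p) : prime p ->
  a \in A -> d != 0 -> (forall x, x \in A -> x + d \in A) -> A = finset.setT.
Proof.
move=> pp Aa d0 stable; apply/finset.setP => x; rewrite inE.
have Ak k : a + d *+ k \in A.
  by elim: k => [|k IHk]; rewrite ?mulr0n ?addr0 // mulrSr addrA stable.
by rewrite -(subrK a x) addrC -[x - a](mulfVK d0) -[_ / _]natr_Zp mulr_natl Ak.
Qed.

Lemma cauchy_davenport (p : nat) (A B : {set 'F_p}) : prime p ->
  (0 < #|A|)%N -> (0 < #|B|)%N ->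
  (minn p (#|A| + #|B|).-1 <= #|A :+: B|)%N.
Proof.
move=> pp; have [n] := ubnP #|B|; elim: n => // n IH in A B *; rewrite ltnS => Bn A0 B0.
have [[a [b0 [b1 [Aa Bb0 Bb1 nA]]]]|stable] := pselect (exists a b0 b1,
    [/\ a \in A, b0 \in B, b1 \in B & b1 + (a - b0) \notin A]).
  have [A' [B' [<- AA' /andP[B'0 B'B] sub]]] := dyson_transform Bb0 Bb1 Aa nA.
  apply: leq_trans (subset_leq_card sub); apply: IH => //; first exact: leq_trans B'B Bn.
  exact: leq_trans A0 (subset_leq_card AA').
have /card_gt0P[b0 Bb0] := B0.
have AS : (#|A| <= #|A :+: B|)%N.
  rewrite -(card_imset A (addIr b0)); apply: subset_leq_card.
  by apply/fintype.subsetP => _ /imsetP[a Aa ->]; exact: imset2_f.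
have [B1|] := leqP #|B| 1; first by apply: leq_trans AS; lia.
rewrite (cardsD1 b0) Bb0 ltnS => /card_gt0P[b1]; rewrite !inE => /andP[b10 Bb1].
have /card_gt0P[a Aa] := A0.
have AT : A = finset.setT.
  apply: (Fp_set_translation_stable pp Aa (d := b1 - b0)) => [|x Ax]; first by rewrite subr_eq0.
  by apply: contrapT => /negP nA; apply: stable; exists x, b0, b1; split => //; rewrite addrCA.
by apply: leq_trans (geq_minl _ _) _; apply: leq_trans AS; rewrite AT cardsT card_Fp.
Qed.

Section Raikov.
Variable R : realType.
Implicit Types (X Y T K L : set R) (D h x y t : R).

Lemma compact_uniform_nbhs (M : pseudoMetricType R) (K U : set M) :
  compact K -> open U -> K `<=` U ->
  exists2 d : R, 0 < d & forall a, K a -> ball a d `<=` U.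
Proof.
move=> /compact_near_coveringP cK oU KU.
have : \forall d \near (0 : R)^'+, K `<=` [set a | ball a d `<=` U].
  apply: cK => a Ka; have /nbhs_ballP[e /= e0 aU] := open_nbhs_nbhs (conj oU (KU _ Ka)).
  near=> b d; have ab : ball a (e / 2) b by near: b; apply: nbhsx_ballx; lra.
  have de : d <= e / 2 by near: d; apply: nbhs_right_le; lra.
  by move=> z /(le_ball de) bz; apply/aU/(ball_split ab).
move=> Kd; have [d [/= Kd' d0]] := filter_ex (filterI Kd (nbhs_right_gt 0)).
by exists d.
Unshelve. all: end_near. Qed.

Lemma compact_sumset K L : compact K -> compact L -> compact (sumset K L).
Proof.
move=> cK cL; rewrite (_ : sumset K L = (fun z : R * R => z.1 + z.2) @` (K `*` L)).
  apply: continuous_compact; last exact: compact_setX.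
  by apply: continuous_subspaceT => z; apply: cvgD; [exact: cvg_fst|exact: cvg_snd].
apply/seteqP; split => x /=; first by case=> a Ka [b Lb] <-; exists (a, b).
by case=> -[a b] [/= Ka Lb] <-; exists a => //; exists b.
Qed.

Lemma mass_grid X h n : measurable X -> 0 <= h ->
  mass X 0 (h *+ n) = \sum_(i < n) mass X (h *+ i) (h *+ i.+1).
Proof.
move=> mX h0; elim: n => [|n IH]; first by rewrite big_ord0 mulr0n mass_degenerate.
rewrite big_ord_recr -IH; apply: massD => //.
by rewrite mulrSr mulrn_wge0 //= lerDl.
Qed.

Definition grid_cell h i : set R := `[h *+ i, h *+ i.+1[%classic.

Definition cells_meeting h n X : {set 'I_n} :=
  [set i : 'I_n | `[< X `&` grid_cell h i !=set0 >]]%SET.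

Definition cells_inside h n X : {set 'I_n} :=
  [set i : 'I_n | `[< grid_cell h i `<=` X >]]%SET.

Lemma grid_cellE h i t : grid_cell h i t = (h *+ i <= t < h *+ i + h) :> Prop.
Proof. by rewrite /grid_cell /= in_itv /= mulrSr. Qed.

Lemma mass_le_cells_meeting X h n : measurable X -> 0 <= h ->
  mass X 0 (h *+ n) <= h *+ #|cells_meeting h n X|.
Proof.
move=> mX h0; rewrite mass_grid // -sumr_const [leRHS]big_mkcond /=; apply: ler_sum => i _.
case: ifPn => [_|].
  by apply: le_trans (mass_le mX _) _; rewrite mulrSr ?lerDl // addrAC subrr add0r.
rewrite inE => /asboolPn nX; apply: (@le_trans _ _ (mass set0 (h *+ i) (h *+ i.+1))).
  apply: (@le_mass_ae _ [set h *+ i.+1]) => //; first exact: negligible_set1.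
  move=> x xi Xx; right; apply/eqP/contraT => xn; exfalso; apply: nX; exists x; split => //.
  by move: xi; rewrite /grid_cell /= in_itv /= lt_neqAle xn => /andP[-> ->].
by rewrite /mass set0I /rmeas measure0.
Qed.

Lemma cells_inside_le_mass X h n : measurable X -> 0 <= h ->
  h *+ #|cells_inside h n X| <= mass X 0 (h *+ n).
Proof.
move=> mX h0; rewrite mass_grid // -sumr_const [leLHS]big_mkcond /=; apply: ler_sum => i _.
case: ifPn => [|_]; last exact: mass_ge0.
have hi : h *+ i <= h *+ i.+1 by rewrite mulrSr lerDl.
rewrite inE => /asboolP iX; apply: (@le_trans _ _ (mass setT (h *+ i) (h *+ i.+1))).
  by rewrite /mass setTI rmeas_itv // mulrSr addrAC subrr add0r.
apply: (@le_mass_ae _ [set h *+ i.+1]) => //; first exact: negligible_set1.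
move=> x /andP[xi]; rewrite le_eqVlt => /orP[/eqP->|xi' _]; [by right|left; apply: iX].
by rewrite /grid_cell /= in_itv /= xi.
Qed.

Lemma cells_meeting_gt0 X h n : 0 < h -> X `&` `[0, h *+ n[ !=set0 ->
  (0 < #|cells_meeting h n X|)%N.
Proof.
move=> h0 [x [Xx /=]]; rewrite in_itv /= => /andP[x0 xn].
have := truncn_itv (divr_ge0 x0 (ltW h0)); rewrite ler_pdivlMr // ltr_pdivrMr // !mulr_natl.
set k := Num.truncn _ => /andP[kx xk].
have kn : (k < n)%N by rewrite -(ltr_pMn2l h0); exact: le_lt_trans kx xn.
apply/card_gt0P; exists (Ordinal kn); rewrite inE; apply/asboolP; exists x; split => //.
by rewrite /grid_cell /= in_itv /= kx.
Qed.

Lemma raikov_grid (p : nat) h D X Y T : prime p -> 0 < h -> h *+ p = D ->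
  measurable X -> measurable Y -> measurable T ->
  X `&` `[0, D[ !=set0 -> Y `&` `[0, D[ !=set0 ->
  (forall x y t, X x -> Y y -> 0 <= t < D ->
     `|t - (x + y)| < 2 * h \/ `|t + D - (x + y)| < 2 * h -> T t) ->
  Num.min D (mass X 0 D + mass Y 0 D - h) <= mass T 0 D.
Proof.
move=> pp h0 hD mX mY mT X0 Y0 XYT; have PE : (Zp_trunc (pdiv p)).+2 = p by exact: Fp_cast.
set P := _.+2 in PE; have hP : h *+ P = D by rewrite PE.
have sub : [set i + j | i in (cells_meeting h P X : {set 'F_p}),
    j in (cells_meeting h P Y : {set 'F_p})]%SET \subset (cells_inside h P T : {set 'F_p}).
  apply/fintype.subsetP => _ /imset2P[i j + + ->]; rewrite !inE.
  move=> [x [Xx xi]] [y [Yy yj]] t.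
  move: xi yj; rewrite !grid_cellE /= -/P => xi yj kt.
  have hij : h *+ (i + j)%N = h *+ i + h *+ j by rewrite mulrnDr.
  have k0 : 0 <= h *+ ((i + j) %% P)%N by rewrite mulrn_wge0 // ltW.
  have kP : h *+ ((i + j) %% P)%N + h <= D.
    by rewrite -hP -mulrSr (ler_pMn2l h0) ltn_mod.
  apply: (XYT x y) => //; first lra.
  have [ijP|ijP] := ltnP (i + j) P.
    by left; move: kt; rewrite modn_small // hij ltr_norml; lra.
  right; have kE : h *+ ((i + j) %% P)%N = h *+ (i + j)%N - D.
    rewrite -{1}(subnK ijP) modnDr modn_small ?mulrnBr ?hP //.
    by rewrite ltn_subLR // -addSn; apply: leq_add; [exact: ltn_ord|exact/ltnW/ltn_ord].
  by move: kt; rewrite kE hij ltr_norml; lra.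
rewrite -hP in X0 Y0 *; have nX := cells_meeting_gt0 h0 X0; have nY := cells_meeting_gt0 h0 Y0.
have hX := mass_le_cells_meeting P mX (ltW h0); have hY := mass_le_cells_meeting P mY (ltW h0).
apply: le_trans (cells_inside_le_mass P mT (ltW h0)).
have : (minn P (#|cells_meeting h P X| + #|cells_meeting h P Y|).-1 <= #|cells_inside h P T|)%N.
  by rewrite {1}PE; apply: leq_trans (cauchy_davenport pp nX nY) (subset_leq_card sub).
rewrite -(ler_pMn2l h0); apply: le_trans; rewrite ge_min.
have [Pm|Pm] := leqP P (#|cells_meeting h P X| + #|cells_meeting h P Y|).-1.
  by rewrite lexx.
rewrite -subn1 mulrnBr ?addn_gt0 ?nX // mulrnDr mulr1n.
by apply/orP; right; lra.
Qed.

Lemma compact_subset_mass D X e : measurable X -> X `&` `[0, D[ !=set0 -> 0 < e ->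
  exists K : set R, [/\ compact K, K `<=` X `&` `[0, D[, K !=set0 & mass X 0 D < mass K 0 D + e].
Proof.
move=> mX [x0 Xx0] e0; have fX : finmeas (X `&` `[0, D[) by measurability.
have [K [cK KX Ke]] := rmeas_inner fX e0; exists (K `|` [set x0]).
have cK0 : compact (K `|` [set x0]) by apply: compactU => //; exact: compact_set1.
have KX0 : K `|` [set x0] `<=` X `&` `[0, D[ by move=> x [/KX|->].
split => //; first by exists x0; right.
rewrite [mass (_ `|` _) _ _]mass_whole; last first.
  by move=> x /KX0[_ /=]; rewrite !in_itv /= => /andP[-> /ltW].
have KK0 : rmeas K <= rmeas (K `|` [set x0]).
  by apply: le_rmeas; [exact: compact_measurable|exact: finmeas_compact|exact: subsetUl].
apply: le_lt_trans (lt_le_trans Ke _); last by rewrite lerD2r.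
apply: le_rmeas_ae; [by measurability|by []|].
apply: negligibleS (negligible_set1 D) => x [[Xx /=]]; rewrite in_itv /= => xD nXx.
apply/eqP/contraT => xn; exfalso; apply: nXx; split => //=.
by rewrite in_itv /= lt_neqAle xn.
Qed.

Lemma open_superset_mass D T e : 0 <= D -> measurable T -> 0 < e ->
  exists U : set R, [/\ open U, T `&` `[0, D[ `<=` U, translate D (T `&` `[0, D[) `<=` U
    & mass (U `|` translate (- D) U) 0 D <= mass T 0 D + 2 * e].
Proof.
move=> D0 mT e0; pose W := T `&` `[0, D[ `|` translate D (T `&` `[0, D[).
have fW : finmeas W by rewrite /W; measurability.
have [U [oU WU fUW Ue]] := rmeas_outer fW e0; have mU := open_measurable oU.
exists U; split => //; [by move=> x Tx; apply: WU; left|by move=> x Tx; apply: WU; right|].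
pose V := U `\` W; have fVt := finmeas_translate (- D) fUW.
apply: (@le_trans _ _ (mass (T `|` (V `|` translate (- D) V)) 0 D)).
  apply: (@le_mass_ae _ [set D]); [by measurability|by measurability|exact: negligible_set1|].
  move=> x /andP[x0]; rewrite le_eqVlt => /orP[/eqP->|xD]; first by right.
  move=> Ux; left; have [Tx|nTx] := pselect (T x); [by left|right].
  case: Ux => Ux; [left|right; move: Ux; rewrite !translateE /= => Ux]; split => //.
    by case=> [[]//|]; rewrite translateE /= => -[_ /=]; rewrite in_itv /=; lra.
  case=> [[_ /=]|]; first by rewrite in_itv /=; lra.
  by rewrite translateE /= => -[]; rewrite opprK addrK.
have [mV mVt] := (fUW.1, fVt.1); have VE : rmeas (translate (- D) V) = rmeas V.
  by rewrite rmeas_translate.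
have := massU_le 0 D mT (measurableU _ _ mV mVt); have := massU_le 0 D mV mVt.
have := mass_le_rmeas 0 D fVt; have := mass_le_rmeas 0 D fUW.
by rewrite VE /V; lra.
Qed.

Lemma small_prime_fraction D e : 0 < D -> 0 < e -> exists2 p : nat, prime p & D / p%:R < e.
Proof.
move=> D0 e0; have [p pD pp] := prime_above (Num.truncn (D / e)); exists p => //.
have p0 : 0 < p%:R :> R by rewrite ltr0n prime_gt0.
have /andP[_ De] := truncn_itv (ltW (divr_gt0 D0 e0)).
by rewrite ltr_pdivrMr // mulrC -ltr_pdivrMr // (lt_le_trans De) // ler_nat.
Qed.

Lemma raikov D X Y T : 0 < D -> measurable X -> measurable Y -> measurable T ->
  X `&` `[0, D[ !=set0 -> Y `&` `[0, D[ !=set0 ->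
  (forall x y, X x -> Y y -> 0 <= x < D -> 0 <= y < D ->
     if x + y < D then T (x + y) else T (x + y - D)) ->
  Num.min D (mass X 0 D + mass Y 0 D) <= mass T 0 D.
Proof.
move=> D0 mX mY mT X0 Y0 XYT.
apply/ler_addgt0Pr => eps eps0; have [e e0 ->] : exists2 e, 0 < e & eps = 5 * e.
  by exists (eps / 5); lra.
have [K [cK KX [k Kk] Ke]] := compact_subset_mass mX X0 e0.
have [L [cL LY [l Ll] Le]] := compact_subset_mass mY Y0 e0.
have [U [oU TU TDU Ue]] := open_superset_mass (ltW D0) mT e0.
have KLU : sumset K L `<=` U.
  move=> _ [x /KX[Xx /=] + [y /LY[Yy /=] + <-]]; rewrite !in_itv /= => xD yD.
  have := XYT x y Xx Yy xD yD; case: ltP => xyD Txy.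
    by apply: TU; split => //=; rewrite in_itv /=; lra.
  by apply: TDU; rewrite translateE; split => //=; rewrite in_itv /=; lra.
have [d d0 dU] := compact_uniform_nbhs (compact_sumset cK cL) oU KLU.
have [p pp pd] : exists2 p : nat, prime p & D / p%:R < Num.min (d / 2) e.
  by apply: small_prime_fraction => //; rewrite lt_min e0 divr_gt0.
have p0 : 0 < p%:R :> R by rewrite ltr0n prime_gt0.
have hD : D / p%:R *+ p = D by rewrite -mulr_natr mulfVK // gt_eqF.
have mU := open_measurable oU.
move: pd; rewrite lt_min => /andP[hd he].
have grid : Num.min D (mass K 0 D + mass L 0 D - D / p%:R) <= mass (U `|` translate (- D) U) 0 D.
  apply: (raikov_grid pp (divr_gt0 D0 p0) hD); [exact: compact_measurable..|by measurability| | |].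
  - by exists k; split => //; exact: (KX _ Kk).2.
  - by exists l; split => //; exact: (LY _ Ll).2.
  have Uxy x y s : K x -> L y -> `|s - (x + y)| < 2 * (D / p%:R) -> U s.
    move=> Kx Ly sxy; apply: (dU (x + y)); first by exists x => //; exists y.
    by rewrite /ball /= distrC; lra.
  move=> x y t Kx Ly _ [/Uxy|/Uxy] Ut; [by left; exact: Ut|right].
  by rewrite translateE /= opprK; exact: Ut.
by move: grid; rewrite !ge_min => /orP[] ?; apply/orP; [left|right]; lra.
Qed.

End Raikov.

(** * Holes of critical sumsets *)

Section Holes.
Variable R : realType.
Implicit Types (D DA DB u v : R) (X S : set R).

Definition holes D X : set R := [set x | 0 <= x <= D /\ ~ X x].

Definition right_holes DA DB S : set R := [set x | 0 <= x <= DB /\ ~ S (DA + x)].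

Lemma measurable_holes D X : measurable X -> measurable (holes D X).
Proof. by move=> mX; rewrite (_ : holes D X = `[0, D] `\` X) //; measurability. Qed.

Lemma finmeas_holes D X : measurable X -> finmeas (holes D X).
Proof.
move=> mX; apply: (finmeas_sub (measurable_holes D mX) (finmeas_itv true false 0 D)).
by move=> x [].
Qed.

Lemma right_holesE DA DB S : right_holes DA DB S = holes DB (translate (- DA) S).
Proof.
by rewrite /right_holes /holes translateE; apply/seteqP; split => x /=; rewrite opprK addrC.
Qed.

Lemma finmeas_right_holes DA DB S : measurable S -> finmeas (right_holes DA DB S).
Proof. by move=> mS; rewrite right_holesE; apply: finmeas_holes; measurability. Qed.

Lemma mass_holes D X u v : measurable X -> 0 <= u -> u <= v -> v <= D ->
  mass (holes D X) u v = v - u - mass X u v.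
Proof.
move=> mX u0 uv vD; rewrite -mass_setC //; apply: le_anti; apply/andP.
have mH := measurable_holes D mX.
split; apply: le_mass; [by []|by measurability| |by measurability|by []|] => x xuv; first by case.
by move=> nX; split => //; lra.
Qed.

Lemma mass_holes_whole D X u v : u <= 0 -> D <= v -> mass (holes D X) u v = rmeas (holes D X).
Proof. by move=> u0 vD; apply: mass_whole => x [xD _]; rewrite /= in_itv /=; lra. Qed.

Lemma rmeas_holes D X : measurable X -> 0 <= D -> rmeas (holes D X) = D - mass X 0 D.
Proof. by move=> mX D0; rewrite -(@mass_holes_whole D X 0 D) // mass_holes // subr0. Qed.

(* [S] may be any measurable set containing the sumset of [A] and [B]. *)
Record critical DA DB (A B S : set R) : Prop := Critical {
  critical_measurableA : measurable A;
  critical_measurableB : measurable B;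
  critical_measurableS : measurable S;
  critical_leD : DB <= DA;
  critical_subA : A `<=` `[0, DA];
  critical_subB : B `<=` `[0, DB];
  critical_subS : S `<=` `[0, DA + DB];
  critical_minA : A 0;
  critical_maxA : A DA;
  critical_minB : B 0;
  critical_maxB : B DB;
  critical_sum : forall a b, A a -> B b -> S (a + b);
  critical_small : rmeas S <= rmeas A + DB;
  critical_large : DB < 2 * rmeas B }.

End Holes.

Section Critical.
Variable R : realType.
Local Notation mu := (@lebesgue_measure R).
Implicit Types (Z : set R) (e f s u v w x : R).
Variables (DA DB : R) (A B S : set R).
Hypothesis cr : critical DA DB A B S.

Let C := holes DA A.
Let E := holes DB S.
Let F := right_holes DA DB S.
Let mA : measurable A := critical_measurableA cr.
Let mB : measurable B := critical_measurableB cr.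
Let mS : measurable S := critical_measurableS cr.
Let leD : DB <= DA := critical_leD cr.

Let fC : finmeas C := finmeas_holes DA mA.
Let fE : finmeas E := finmeas_holes DB mS.
Let fF : finmeas F := finmeas_right_holes DA DB mS.
Let mC : measurable C := proj1 fC.
Let mE : measurable E := proj1 fE.
Let mF : measurable F := proj1 fF.

Lemma critical_memA x : A x -> 0 <= x <= DA.
Proof. by move/(critical_subA cr); rewrite /= in_itv. Qed.

Lemma critical_memB x : B x -> 0 <= x <= DB.
Proof. by move/(critical_subB cr); rewrite /= in_itv. Qed.

Lemma critical_B_subS x : B x -> S x.
Proof. by move=> Bx; rewrite -[x]add0r; exact: critical_sum cr _ _ (critical_minA cr) Bx. Qed.

Lemma critical_translateB_subS x : B x -> S (DA + x).
Proof. exact: critical_sum cr _ _ (critical_maxA cr). Qed.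

Lemma massAE u v : u <= 0 -> DA <= v -> mass A u v = rmeas A.
Proof.
by move=> u0 vD; apply: mass_whole => x /critical_memA xD; rewrite /= in_itv /=; lra.
Qed.

Lemma massBE u v : u <= 0 -> DB <= v -> mass B u v = rmeas B.
Proof.
by move=> u0 vD; apply: mass_whole => x /critical_memB xD; rewrite /= in_itv /=; lra.
Qed.

Lemma massSE u v : u <= 0 -> DA + DB <= v -> mass S u v = rmeas S.
Proof.
move=> u0 vD; apply: mass_whole => x /(critical_subS cr).
by rewrite /= !in_itv /=; lra.
Qed.

Lemma critical_DB_gt0 : 0 < DB.
Proof.
have DB0 : 0 <= DB by have := critical_memB (critical_maxB cr); lra.
by have := mass_le mB DB0; rewrite massBE //; have := critical_large cr; lra.
Qed.

Let DB0 : 0 < DB := critical_DB_gt0.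

Ltac diam_lra := move: leD DB0; lra.

Lemma rmeas_holesA : rmeas C = DA - rmeas A.
Proof. by rewrite rmeas_holes ?massAE //; diam_lra. Qed.

(* Modulo [DA] the sumset covers [B] twice, so Raikov's inequality forces it to be everything. *)
Lemma critical_circle : DA + rmeas B <= rmeas A + DB.
Proof.
have mS' : measurable (translate (- DA) S) by measurability.
have circle : Num.min DA (mass A 0 DA + mass B 0 DA) <= mass (S `|` translate (- DA) S) 0 DA.
  apply: raikov => //; [by diam_lra|by measurability| | |].
  - by exists 0; split; [exact: critical_minA cr|rewrite /= in_itv /=; diam_lra].
  - by exists 0; split; [exact: critical_minB cr|rewrite /= in_itv /=; diam_lra].
  move=> a b Aa Bb _ _; have Sab := critical_sum cr Aa Bb; case: ifP => _; first by left.
  by right; rewrite translateE /= opprK subrK.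
have twice : rmeas B <= mass (S `&` translate (- DA) S) 0 DA.
  rewrite -(@massBE 0 DA) //; apply: le_mass; [by []|by measurability|] => x _ Bx.
  split; first exact: critical_B_subS.
  by rewrite translateE /= opprK addrC; exact: critical_translateB_subS.
have cover : mass S 0 DA + mass (translate (- DA) S) 0 DA = rmeas S.
  rewrite mass_translate // opprK add0r -massD //; last diam_lra.
  by apply: massSE; diam_lra.
move: circle; rewrite massAE // massBE // ge_min => circle.
have := massUI 0 DA mS mS'; have := critical_small cr; have := critical_large cr.
by case/orP: circle; diam_lra.
Qed.

Lemma rmeas_holesA_le : rmeas C <= DB - rmeas B.
Proof. by rewrite rmeas_holesA; have := critical_circle; diam_lra. Qed.

Lemma rmeas_holesA_lt : rmeas C < rmeas B.
Proof. by have := rmeas_holesA_le; have := critical_large cr; diam_lra. Qed.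

Lemma hole_window s u v : ~ S s -> v <= s -> s <= DA + u ->
  mass B u v <= mass C (s - v) (s - u).
Proof.
move=> nS vs su; rewrite -mass_reflect_at //; apply: le_mass; [by []|by measurability|].
move=> x xuv Bx; rewrite reflect_atE /=; split; first diam_lra.
by move=> Asx; apply: nS; rewrite -(subrK x s); exact: critical_sum cr _ _ Asx Bx.
Qed.

Lemma left_hole_window e u v : E e -> 0 <= u -> v <= e -> mass B u v <= mass C (e - v) (e - u).
Proof. by move=> [e0 nS] u0 ve; apply: hole_window => //; diam_lra. Qed.

Lemma right_hole_window f u v : F f -> f <= u -> v <= DB ->
  mass B u v <= mass C (DA + f - v) (DA + f - u).
Proof. by move=> [f0 nS] fu vD; apply: hole_window => //; diam_lra. Qed.

Lemma left_hole_mass_le e : E e -> mass B 0 e <= mass C 0 e.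
Proof. by move=> Ee; have := @left_hole_window e 0 e Ee; rewrite subrr subr0; apply. Qed.

Lemma right_hole_mass_le f : F f -> mass B f DB <= mass C (f + (DA - DB)) DA.
Proof.
move=> Ff; have := @right_hole_window f f DB Ff; rewrite addrK.
by rewrite (_ : DA + f - DB = f + (DA - DB)); [apply|diam_lra].
Qed.

Lemma holes_overlap e f : E e -> F f -> f <= e ->
  rmeas B - rmeas C <= mass C (f + (DA - DB)) e.
Proof.
move=> Ee Ff fe; have [e0 _] := Ee; have [f0 _] := Ff.
have := left_hole_mass_le Ee; have := right_hole_mass_le Ff; have C0 := mass_ge0 C.
have : rmeas B <= mass B 0 e + mass B f DB.
  rewrite -(@massBE 0 DB) // (massD mB (_ : 0 <= e <= DB)) // (@massD _ B f e); [|by []|diam_lra].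
  by have := mass_ge0 B f e; diam_lra.
have mCE := @mass_holes_whole _ DA A 0 DA (lexx _) (lexx _).
have [fe'|ef] := leP (f + (DA - DB)) e.
  have := @massD _ C 0 (f + (DA - DB)) e mC ltac:(diam_lra).
  have := @massD _ C 0 (f + (DA - DB)) DA mC ltac:(diam_lra).
  diam_lra.
have := @massD _ C 0 e DA mC ltac:(diam_lra).
have := @massD _ C e (f + (DA - DB)) DA mC ltac:(diam_lra).
have := C0 e (f + (DA - DB)); have := C0 (f + (DA - DB)) e; diam_lra.
Qed.

Lemma critical_middle x : DB <= x <= DA -> S x.
Proof.
move=> xD; apply: contrapT => nS; have := @hole_window x 0 DB nS.
rewrite (massBE (lexx _) (lexx _)) => /(_ ltac:(diam_lra) ltac:(diam_lra)).
have := @mass_le_rmeas _ C (x - DB) (x - 0) fC.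
by have := rmeas_holesA_lt; diam_lra.
Qed.

Lemma left_hole_sub : E `<=` C.
Proof.
move=> e [e0 nS]; split; first diam_lra.
by move=> Ae; apply: nS; rewrite -[e]addr0; exact: critical_sum cr _ _ Ae (critical_minB cr).
Qed.

Lemma right_hole_sub f : F f -> C (f + (DA - DB)).
Proof.
move=> [f0 nS]; split; first diam_lra.
move=> Af; apply: nS; rewrite (_ : DA + f = f + (DA - DB) + DB); last diam_lra.
exact: critical_sum cr _ _ Af (critical_maxB cr).
Qed.

Lemma holes_separated e f : E e -> F f -> f <= e -> f + (DA - DB) < e.
Proof.
move=> Ee Ff fe; rewrite ltNge; apply/negP => ef; have := holes_overlap Ee Ff fe.
by rewrite mass_degenerate //; have := rmeas_holesA_lt; diam_lra.
Qed.

Lemma left_right_holes_disjoint : E `&` translate (DA - DB) F `<=` set0.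
Proof.
move=> x [Ex]; rewrite translateE /= => Fx.
by have := holes_separated Ex Fx; rewrite subrK ltxx => h; suff: false by []; apply: h; diam_lra.
Qed.

Lemma rmeasS_holes : rmeas S + rmeas E + rmeas F = DA + DB.
Proof.
have mid : mass S DB DA = DA - DB by apply: mass_full => // x; exact: critical_middle.
have FE : rmeas F = DB - mass S DA (DA + DB).
  rewrite /F right_holesE rmeas_holes ?(ltW DB0) ?mass_translate ?opprK ?add0r //.
    by rewrite [DB + DA]addrC.
  by measurability.
rewrite FE rmeas_holes ?(ltW DB0) // -(@massSE 0 (DA + DB)) //.
have := @massD _ S 0 DB DA mS ltac:(diam_lra).
have := @massD _ S 0 DA (DA + DB) mS ltac:(diam_lra); diam_lra.
Qed.

Lemma critical_equality :
  rmeas S = rmeas A + DB /\ mu.-negligible (C `\` (E `|` translate (DA - DB) F)).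
Proof.
have fU : finmeas (E `|` translate (DA - DB) F) by measurability.
have fD : finmeas (C `\` (E `|` translate (DA - DB) F)) by measurability.
have := rmeasID fC (proj1 fU); rewrite setIidr; last first.
  by move=> x [/left_hole_sub//|]; rewrite translateE => /right_hole_sub; rewrite subrK.
rewrite rmeasU; [|by measurability..|exact: left_right_holes_disjoint].
rewrite rmeas_translate // rmeas_holesA => rE.
have := rmeas_ge0 (C `\` (E `|` translate (DA - DB) F)); have := rmeasS_holes.
have := critical_small cr => small sumE pos; split; first diam_lra.
by apply/(rmeas_negligible fD); diam_lra.
Qed.

Lemma critical_negligible Z : Z `<=` C -> mu.-negligible (Z `&` E) ->
  mu.-negligible (Z `&` translate (DA - DB) F) -> mu.-negligible Z.
Proof.
move=> ZC ZE ZF; apply: negligibleS (negligibleU (proj2 critical_equality) (negligibleU ZE ZF)).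
move=> x Zx; have [Ex|nE] := pselect (E x); first by right; left.
have [Fx|nF] := pselect (translate (DA - DB) F x); first by right; right.
by left; split; [exact: ZC|case].
Qed.

Lemma mass_holes_gap u v : (forall e, E e -> ~ u < e < v) ->
  (forall f, F f -> ~ u < f + (DA - DB) < v) -> mass C u v = 0.
Proof.
move=> Euv Fuv; apply: mass_eq0 => //; apply: critical_negligible; first by move=> x [].
  by apply: negligible_subset0 => x [[_ /=] + Ex]; rewrite in_itv; exact: Euv.
apply: negligible_subset0 => x [[_ /=]]; rewrite in_itv translateE => xuv Fx.
by apply: (Fuv _ Fx); rewrite subrK.
Qed.

Lemma left_holes_lt_right_holes e f : E e -> F f -> e < f.
Proof.
move=> Ee Ff; rewrite ltNge; apply/negP => fe.
have CB := rmeas_holesA_lt; pose k := (rmeas B - rmeas C) / 3.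
have k0 : 0 < k by rewrite divr_gt0 //; lra.
pose Fe : set R := [set f' | F f' /\ f' <= e].
have sF : has_sup Fe by split; [exists f|exists e => x []].
have [f1 [Ff1 f1e] f1k] := sup_adherent k0 sF; have f1s := ub_le_sup sF.2 (conj Ff1 f1e).
set s := sup Fe in f1k f1s.
have sFe : s + (DA - DB) <= e.
  rewrite -lerBrDr; apply: (ge_sup sF.1) => x [Fx xe].
  by have := holes_separated Ee Fx xe; lra.
pose Es : set R := [set e' | E e' /\ s + (DA - DB) <= e'].
have iE : has_inf Es by split; [exists e|exists (s + (DA - DB)) => x []].
have [e1 [Ee1 e1s] e1k] := inf_adherent k0 iE; have e1i := ge_inf iE.2 (conj Ee1 e1s).
set i := inf Es in e1k e1i.
have si : s + (DA - DB) <= i by apply: (lb_le_inf iE.1) => x [].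
have ie : i <= e by apply: (ge_inf iE.2).
have gap : mass C (s + (DA - DB)) i = 0.
  apply: mass_holes_gap => x Ux xsi.
    have : i <= x by apply: (ge_inf iE.2); split => //; lra.
    lra.
  have : x <= s by apply: (ub_le_sup sF.2); split => //; diam_lra.
  lra.
have := holes_overlap Ee1 Ff1 ltac:(diam_lra).
have := @massD _ C (f1 + (DA - DB)) (s + (DA - DB)) e1 mC ltac:(lra).
have := @massD _ C (s + (DA - DB)) i e1 mC ltac:(lra).
have := @mass_le _ C (f1 + (DA - DB)) (s + (DA - DB)) mC ltac:(lra).
have := @mass_le _ C i e1 mC ltac:(lra).
by rewrite gap /k in f1k e1k *; lra.
Qed.

(* Let [s] be the supremum of the right holes up to [w]. Above [s + (DA - DB)] and below
   [w + (DA - DB)] there are no holes, so a right hole close to [s] reflects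
   [B `&` `[w, DB]] into the part of [C] above [w + (DA - DB)] up to a small error. *)
Lemma mass_above_right_hole f w : F f -> f <= w <= DB ->
  mass B w DB <= mass C (w + (DA - DB)) DA.
Proof.
move=> Ff fw; apply/ler_addgt0Pr => d d0.
pose Fw : set R := [set f' | F f' /\ f' <= w].
have sF : has_sup Fw by split; [exists f; split => //; lra|exists w => x []].
have [f1 [Ff1 f1w] f1d] := sup_adherent d0 sF; have f1s := ub_le_sup sF.2 (conj Ff1 f1w).
set s := sup Fw in f1d f1s; have sw : s <= w by apply: (ge_sup sF.1) => x [].
have gap : mass C (s + (DA - DB)) (w + (DA - DB)) = 0.
  apply: mass_holes_gap => x Ux xsw.
    by have := left_holes_lt_right_holes Ux Ff1; diam_lra.
  have : x <= s by apply: (ub_le_sup sF.2); split => //; lra.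
  lra.
have [f10 _] := Ff1; pose v := f1 + (DB - w).
have := @right_hole_window f1 f1 v Ff1 ltac:(lra) ltac:(rewrite /v; lra).
have := @right_hole_window f1 v DB Ff1 ltac:(rewrite /v; lra) ltac:(lra).
have -> : DA + f1 - v = w + (DA - DB) by rewrite /v; lra.
have -> : DA + f1 - DB = f1 + (DA - DB) by lra.
rewrite addrK.
have := @massD _ C (f1 + (DA - DB)) (s + (DA - DB)) (w + (DA - DB)) mC ltac:(lra).
have := @mass_le _ C (f1 + (DA - DB)) (s + (DA - DB)) mC ltac:(lra).
have := @massD _ B f1 v DB mB ltac:(rewrite /v; lra); have := @massD _ B f1 w DB mB ltac:(lra).
by have := mass_ge0 B f1 w; lra.
Qed.

Lemma mass_below_right_hole f w : F f -> f <= w <= DB ->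
  rmeas E + mass F 0 w + mass B 0 w <= w.
Proof.
move=> Ff fw; have [f0 _] := Ff.
have EE : mass E 0 w = rmeas E.
  apply: mass_whole => e Ee; have := left_holes_lt_right_holes Ee Ff; have [e0 _] := Ee.
  by rewrite /= in_itv /=; lra.
have disj X Y : X `&` Y `<=` set0 -> mass (X `&` Y) 0 w = 0.
  by rewrite subset0 => ->; rewrite /mass set0I /rmeas measure0.
have := massUI 0 w mE mF; rewrite EE disj; last first.
  by move=> x [Ex Fx]; have := left_holes_lt_right_holes Ex Fx; lra.
have := massUI 0 w (measurableU _ _ mE mF) mB; rewrite disj; last first.
  move=> x [[[_ nS]|[_ nS]] Bx]; apply: nS.
    exact: critical_B_subS.
  exact: critical_translateB_subS.
by have := @mass_le _ (E `|` F `|` B) 0 w ltac:(measurability) ltac:(lra); lra.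
Qed.

Lemma mass_holesA_below w : 0 <= w -> mass C 0 (w + (DA - DB)) <= rmeas E + mass F 0 w.
Proof.
move=> w0; have mF' : measurable (translate (DA - DB) F) by measurability.
apply: le_trans (_ : mass (E `|` translate (DA - DB) F) 0 (w + (DA - DB)) <= _).
  apply: (le_mass_ae mC _ (proj2 critical_equality)); first by measurability.
  by move=> x _ Cx; have [?|?] := pselect ((E `|` translate (DA - DB) F) x); [left|right].
apply: le_trans (massU_le _ _ mE mF') _; apply: lerD; first exact: mass_le_rmeas.
rewrite mass_translate // addrK; apply: le_rmeas; [by measurability|exact: finmeas_mass|].
by move=> x [Fx]; have [x0 _] := Fx; rewrite /= !in_itv /= => xw; split => //; lra.
Qed.

Lemma mass_holesA_above_right_hole f w : F f -> f <= w <= DB ->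
  2 * mass C 0 (w + (DA - DB)) <= w + rmeas C - rmeas B.
Proof.
move=> Ff fw; have [f0 _] := Ff; have mCE := @mass_holes_whole _ DA A 0 DA (lexx _) (lexx _).
have mBE := @massBE 0 DB (lexx _) (lexx _).
have := mass_above_right_hole Ff fw; have := mass_below_right_hole Ff fw.
have := @mass_holesA_below w ltac:(lra).
have := @massD _ C 0 (w + (DA - DB)) DA mC ltac:(diam_lra).
by have := @massD _ B 0 w DB mB ltac:(lra); lra.
Qed.

Lemma critical_reflect_at :
  critical DA DB (reflect_at DA A) (reflect_at DB B) (reflect_at (DA + DB) S).
Proof.
split; [by measurability|by measurability|by measurability|exact: leD|..].
- by rewrite reflect_atE => x /critical_memA xD; rewrite /= in_itv /=; lra.
- by rewrite reflect_atE => x /critical_memB xD; rewrite /= in_itv /=; lra.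
- by rewrite reflect_atE => x /(critical_subS cr); rewrite /= !in_itv /=; lra.
- by rewrite reflect_atE /= subr0; exact: critical_maxA cr.
- by rewrite reflect_atE /= subrr; exact: critical_minA cr.
- by rewrite reflect_atE /= subr0; exact: critical_maxB cr.
- by rewrite reflect_atE /= subrr; exact: critical_minB cr.
- by rewrite !reflect_atE => a b Aa Bb; have := critical_sum cr Aa Bb; rewrite /= opprD addrACA.
- by rewrite !rmeas_reflect_at //; exact: critical_small cr.
- by rewrite rmeas_reflect_at //; exact: critical_large cr.
Qed.

End Critical.

(** * Sets of density at most one half near an end point *)

Section HalfDensity.
Variable R : realType.
Local Notation mu := (@lebesgue_measure R).
Implicit Types (f u v x y : R).
Variables (DA DB : R) (A B S : set R).
Hypothesis cr : critical DA DB A B S.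

Let F := right_holes DA DB S.
Let mA : measurable A := critical_measurableA cr.
Let mB : measurable B := critical_measurableB cr.
Let mS : measurable S := critical_measurableS cr.

Variable c : R.
Hypotheses (c0 : 0 < c) (cD : c <= DA) (Ac : mass A 0 c <= c / 2).

Ltac half_lra := move: c0 cD Ac (critical_leD cr) (critical_DB_gt0 cr); lra.

Lemma half_density_right_hole f : F f -> c <= f + (DA - DB).
Proof.
move=> Ff; rewrite leNgt; apply/negP => fc; pose w := c - (DA - DB).
have wf : f <= w <= DB by rewrite /w; half_lra.
have := mass_holesA_above_right_hole cr Ff wf.
rewrite /w subrK mass_holes // ?(ltW c0) //.
by have := rmeas_holesA_le cr; have := critical_large cr; half_lra.
Qed.

Lemma half_density_stable : mu.-negligible ((S `&` `[0, c[) `\` A).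
Proof.
apply: (critical_negligible cr).
- by move=> x [[_ /=]]; rewrite in_itv /= => xc nA; split => //; half_lra.
- by apply: negligible_subset0 => x [[[Sx _] _] []].
apply: negligible_subset0 => x [[[_ /=]]]; rewrite in_itv translateE /= => xc _.
by move=> /half_density_right_hole; half_lra.
Qed.

Lemma half_density_mass_le u v : 0 <= u -> v <= c -> mass S u v <= mass A u v.
Proof.
move=> u0 vc; apply: (le_mass_ae _ _ (negligibleU half_density_stable (negligible_set1 c))) => //.
move=> x xuv Sx; have [Ax|nA] := pselect (A x); [by left|right].
have [->|xc] := eqVneq x c; [by right|left].
by split => //; split => //=; rewrite in_itv /= lt_neqAle xc; half_lra.
Qed.

Section Steps.
Variable x : R.
Hypotheses (Bx : B x) (x0 : 0 < x) (xc : x <= c).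

Ltac step_lra := move: x0 xc; half_lra.

(* A sum below [y + x] lies in [S], hence almost surely in [A], and [x \in B] moves it to the
   next window: so the next window contains the sums modulo [x]. *)
Lemma half_density_step y : 0 <= y -> y + x <= c -> 0 < mass A y (y + x) ->
  Num.min x (mass A y (y + x) + mass B 0 x) <= mass S (y + x) (y + x + x).
Proof.
move=> y0 yc A0; pose N := (S `&` `[0, c[) `\` A.
pose T := translate (- (y + x)) S `|` translate (- y) (S `\` A).
have mT : measurable T by rewrite /T; measurability.
have [z Az zy] := mass_gt0_ex mA A0.
apply: le_trans (_ : mass T 0 x <= _).
  have -> : mass A y (y + x) = mass (translate (- y) A) 0 x.
    by rewrite mass_translate //; congr mass; step_lra.
  apply: raikov => //; [by measurability| | |].
  - by exists (z - y); split; rewrite ?translateE /= ?opprK ?subrK // in_itv /=; step_lra.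
  - by exists 0; split; [exact: critical_minB cr|rewrite /= in_itv /=; step_lra].
  move=> t b; rewrite /T !translateE /= !opprK => Aty Bb tx bx.
  have Stb : S (t + b + y) by rewrite addrAC; exact: critical_sum cr _ _ Aty Bb.
  case: ifP => _; last by left; rewrite (_ : _ + (y + x) = t + b + y) //; step_lra.
  have [At|nA] := pselect (A (t + b + y)); [left|by right].
  by rewrite addrA; exact: critical_sum cr _ _ At Bx.
have -> : mass S (y + x) (y + x + x) = mass (translate (- (y + x)) S) 0 x.
  by rewrite mass_translate //; congr mass; step_lra.
have N0 := negligibleU (negligible_translate (- y) half_density_stable) (negligible_set1 x).
apply: (le_mass_ae mT _ N0); first by measurability.
move=> t tx [|Nt]; [by left|right]; have [->|tx'] := eqVneq t x; [by right|left].
move: Nt; rewrite !translateE /= !opprK => -[St nA]; split => //; split => //=.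
by have tx'' : t < x; rewrite ?in_itv /= ?lt_neqAle ?tx' //=; step_lra.
Qed.

Let a : R := x ^+ 2 / c.
Let a0 : 0 < a.
Proof. by rewrite divr_gt0 // exprn_gt0. Qed.

Let acE : a * c = x ^+ 2.
Proof. by rewrite /a divfK // gt_eqF. Qed.

Let xk0 k : 0 <= x *+ k.
Proof. by rewrite mulrn_wge0 // ltW. Qed.

Let a_le k : (a *+ k <= x) = (x *+ k <= c).
Proof. by rewrite -(ler_pM2r c0) mulrnAl acE expr2 -mulrnAr ler_pM2l. Qed.

Section Growth.
Hypothesis dense : a <= mass B 0 x.

Lemma half_density_growth k : x *+ k.+1 <= c -> a *+ k.+1 <= mass A (x *+ k) (x *+ k.+1).
Proof.
elim: k => [|k IH] kc; apply: le_trans (half_density_mass_le (xk0 _) kc).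
  rewrite mulr0n !mulr1n; apply: le_trans dense _.
  by apply: le_mass => // y _; exact: (critical_B_subS cr).
have kc' : x *+ k + x <= c by rewrite -mulrSr; apply: le_trans kc; rewrite [leRHS]mulrSr lerDl ltW.
have {}IH : a *+ k.+1 <= mass A (x *+ k) (x *+ k + x) by rewrite -mulrSr IH // mulrSr.
have Ak : 0 < mass A (x *+ k) (x *+ k + x) by apply: lt_le_trans IH; rewrite pmulrn_lgt0.
rewrite [x *+ k.+2]mulrSr !(mulrSr x k); apply: le_trans (half_density_step (xk0 k) kc' Ak).
by rewrite le_min a_le kc /= [leLHS]mulrSr lerD.
Qed.

Lemma half_density_prefix n : x *+ n <= c -> a * (n%:R * n.+1%:R / 2) <= mass A 0 (x *+ n).
Proof.
elim: n => [|n IH] nc; first by rewrite !mul0r mulr0 mass_ge0.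
have nc' : x *+ n <= x *+ n.+1 by rewrite mulrSr lerDl ltW.
rewrite (@massD _ A 0 (x *+ n)) ?xk0 //.
apply: le_trans (lerD (IH (le_trans nc' nc)) (half_density_growth nc)).
by rewrite -[a *+ _]mulr_natr -!natr1 le_eqVlt; apply/orP; left; apply/eqP; field.
Qed.

Lemma half_density_suffix q : (0 < q)%N -> x *+ q <= c -> c < x *+ q.+1 ->
  c - x *+ q <= mass A (x *+ q) c.
Proof.
case: q => // q _ qc cq; have qc' : x *+ q + x <= c by rewrite -mulrSr.
have Ak : 0 < mass A (x *+ q) (x *+ q + x).
  by rewrite -mulrSr; apply: lt_le_trans (half_density_growth qc); rewrite pmulrn_lgt0.
have Sq : x <= mass S (x *+ q.+1) (x *+ q.+2).
  rewrite [x *+ q.+2]mulrSr (mulrSr x q); apply: le_trans (half_density_step (xk0 q) qc' Ak).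
  rewrite le_min lexx /=; apply: le_trans (_ : a *+ q.+2 <= _).
    by apply: ltW; rewrite ltNge a_le -ltNge.
  by rewrite [leLHS]mulrSr lerD // -mulrSr half_density_growth.
apply: le_trans (half_density_mass_le (xk0 _) (lexx c)).
have cq' := ltW cq; have := @massD _ S (x *+ q.+1) c (x *+ q.+2) mS; rewrite qc cq' => /(_ isT) SD.
have := mass_le mS cq'; move: SD Sq; rewrite [x *+ q.+2]mulrSr; step_lra.
Qed.

End Growth.

Lemma half_density_endpoint : mass B 0 x < x ^+ 2 / c.
Proof.
rewrite ltNge; apply/negP => dense.
have [q [q0 qc cq]] : exists q, [/\ (0 < q)%N, x *+ q <= c & c < x *+ q.+1].
  exists (Num.truncn (c / x)); have /andP[t1 t2] := truncn_itv (divr_ge0 (ltW c0) (ltW x0)).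
  split; first by rewrite truncn_gt0 ler_pdivlMr // mul1r.
  - by rewrite -mulr_natl -ler_pdivlMr.
  - by rewrite -mulr_natl -ltr_pdivrMr.
have := half_density_prefix dense qc; have := half_density_suffix dense q0 qc cq.
have := @massD _ A 0 (x *+ q) c mA; rewrite xk0 qc => /(_ isT) AD.
rewrite -natr1 -[x *+ q]mulr_natr in AD *; set Q : R := q%:R in AD * => suff pre.
have aQ : a * (Q * (Q + 1) / 2) + (c - x * Q) <= c / 2 by move: AD suff pre; step_lra.
have : (a * (Q * (Q + 1) / 2) + (c - x * Q)) * (2 * c) <= c / 2 * (2 * c).
  by rewrite ler_wpM2r //; step_lra.
have -> : (a * (Q * (Q + 1) / 2) + (c - x * Q)) * (2 * c) =
  (a * c) * (Q * (Q + 1)) + 2 * c * (c - x * Q) by field.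
have Q0 : 0 < Q by rewrite ltr0n.
have : 0 < x ^+ 2 * Q by rewrite mulr_gt0 // exprn_gt0.
by rewrite acE; have := sqr_ge0 (x * Q - c); rewrite -?expr2; nra.
Qed.

End Steps.

Lemma half_density_bound x : 0 < x <= c -> mass B 0 x <= x ^+ 2 / c.
Proof.
move=> xI; rewrite leNgt; apply/negP => dense; pose d := mass B 0 x - x ^+ 2 / c.
have d0 : 0 < d by rewrite subr_gt0.
have B0 := critical_minB cr.
have sB : has_sup (B `&` `[0, x]).
  split; first by exists 0; split; rewrite //= in_itv /=; lra.
  by exists x => y [_ /=]; rewrite in_itv /= => /andP[].
have [y [By /=]] := sup_adherent d0 sB; rewrite in_itv /= => yx yd.
have ys : y <= sup (B `&` `[0, x]) by apply: (ub_le_sup sB.2); split.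
set s := sup _ in yd ys.
have sx : s <= x by apply: (ge_sup sB.1) => z [_ /=]; rewrite in_itv /= => /andP[].
have Bs : mass B s x = 0.
  apply: mass_eq0 => //; apply: negligible_subset0 => z [Bz /=]; rewrite in_itv /= => zsx.
  have : z <= s by apply: (ub_le_sup sB.2); split => //=; rewrite in_itv /=; half_lra.
  half_lra.
have := @massD _ B 0 s x mB ltac:(half_lra); have := @massD _ B 0 y s mB ltac:(half_lra).
have := mass_le mB ys => Bys B0s B0x.
have dE : d = mass B 0 x - x ^+ 2 / c by [].
have xc0 : 0 <= x ^+ 2 / c by rewrite divr_ge0 ?sqr_ge0 // ltW.
have y0 : 0 < y.
  rewrite lt_neqAle; apply/andP; split; last half_lra.
  apply/eqP => y0; move: B0s; rewrite -y0 (@mass_degenerate _ B 0 0) //.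
  by rewrite -y0 in yd Bys; lra.
have := half_density_endpoint By y0 ltac:(half_lra).
have : y ^+ 2 / c <= x ^+ 2 / c by rewrite ler_pM2r ?invr_gt0 // lerXn2r ?nnegrE //; half_lra.
half_lra.
Qed.

End HalfDensity.

(** * The case without right holes *)

Section MonotoneWindows.
Variable R : realType.
Local Notation mu := (@lebesgue_measure R).
Implicit Types (X : set R) (u v s l h M : R).

Lemma dense_window X u v eps : measurable X -> 0 < mass X u v -> 0 < eps ->
  exists u' v', [/\ u <= u', u' < v', v' <= v & (1 - eps) * (v' - u') <= mass X u' v'].
Proof.
move=> mX X0 eps0; have [N [mN N0 XN]] := lebesgue_density mX.
have nN : mu.-negligible N by apply/negligibleP.
have [x [Xx nNx] xuv] : exists2 x, (X `\` N) x & u < x < v.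
  apply: mass_gt0_ex; first by measurability.
  apply: lt_le_trans X0 _; apply: (le_mass_ae mX _ nN); first by measurability.
  by move=> x _ Xx; have [?|?] := pselect (N x); [right|left].
have {}XN := contrapT (fun nP => nNx (XN x nP)); rewrite /= indicE mem_set // in XN.
have dense : \forall r \near (0 : R)^'+, ((1 - eps)%:E < mu (X `&` ball x r) / mu (ball x r))%E.
  apply: (XN [set y | ((1 - eps)%:E < y)%E]).
  apply: open_nbhs_nbhs; split; first exact: open_ereal_gt_ereal.
  by rewrite /= lte_fin; lra.
have small : \forall r \near (0 : R)^'+, r < Num.min (x - u) (v - x).
  by apply: nbhs_right_lt; rewrite lt_min; lra.
have [r [[rdense rsmall] r0]] := filter_ex (filterI (filterI dense small) (nbhs_right_gt 0)).
move: rsmall; rewrite lt_min => /andP[rx rv].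
exists (x - r), (x + r); split; [by lra|by lra|by lra|].
have fI : finmeas (`]x - r, x + r[%classic : set R) by measurability.
have fXI : finmeas (X `&` `]x - r, x + r[) by measurability.
move: rdense; rewrite (_ : ball x r = `]x - r, x + r[%classic :> set R); last exact: ball_itv.
rewrite !rmeasE // inver rmeas_itv; last by lra.
rewrite gt_eqF; last by lra.
rewrite -EFinM lte_fin ltr_pdivlMr; last by lra.
move=> /ltW /le_trans; apply; apply: le_rmeas; [by measurability|exact: finmeas_mass|].
by move=> y [Xy /=]; rewrite in_itv /= => yI; split => //=; rewrite in_itv /=; lra.
Qed.

(* Shifts by arbitrarily small steps compose to approximate any shift. *)
Lemma mass_window_monotone X M : measurable X ->
  (forall d, 0 < d -> exists2 s, 0 < s < d &
     forall u v, 0 <= u -> v + s <= M -> mass X u v <= mass X (u + s) (v + s)) ->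
  forall u v l, 0 <= u -> 0 <= l -> v + l <= M -> mass X u v <= mass X (u + l) (v + l).
Proof.
move=> mX steps u v l u0 l0 vl; apply/ler_addgt0Pr => e e0.
have [s s0 Xs] := steps _ e0; have s1 : 0 < s by lra.
have iter k : v + s *+ k <= M -> mass X u v <= mass X (u + s *+ k) (v + s *+ k).
  elim: k => [|k IHk] kM; first by rewrite mulr0n !addr0.
  have k0 : 0 <= s *+ k by rewrite mulrn_wge0 // ltW.
  move: kM; rewrite mulrSr !addrA => kM; apply: le_trans (IHk _) _; first by lra.
  by apply: Xs => //; lra.
have /andP[] := truncn_itv (divr_ge0 l0 (ltW s1)); set n := Num.truncn _.
rewrite ler_pdivlMr // ltr_pdivrMr // !mulr_natl mulrSr => sn ns.
apply: le_trans (iter n _) _; first lra.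
have := @mass_le_trim_left _ X (u + s *+ n) (u + l) (v + s *+ n) mX ltac:(lra).
have := @mass_sub_itv _ X (u + l) (v + s *+ n) (u + l) (v + l) mX (lexx _) ltac:(lra).
lra.
Qed.

(* By Lebesgue density some window is almost full, and all later windows are at least as full. *)
Lemma monotone_windows_full X M : measurable X ->
  (forall u v l, 0 <= u -> 0 <= l -> v + l <= M -> mass X u v <= mass X (u + l) (v + l)) ->
  (forall h, 0 < h -> 0 < mass X 0 h) -> M <= mass X 0 M.
Proof.
move=> mX mono pos; have [M0|M0] := leP M 0; first exact: le_trans M0 (mass_ge0 _ _ _).
apply/ler_addgt0Pr => e e0.
have [h [h0 hM he]] : exists h, [/\ 0 < h, h < M & 3 * h < e].
  have := @ge_min _ _ (e / 4) (M / 2) (e / 4); rewrite lexx orbT => me.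
  exists (Num.min (M / 2) (e / 4)); split; [by rewrite lt_min; lra|by rewrite gt_min; lra|lra].
pose eps := h / M; have eps0 : 0 < eps by rewrite divr_gt0.
have [u [v [u0 uv vh dens]]] := dense_window mX (pos h h0) eps0.
pose l := v - u; have l0 : 0 < l by rewrite /l; lra.
have iter n : h + l *+ n <= M -> (1 - eps) * (l *+ n) <= mass X h (h + l *+ n).
  elim: n => [|n IHn] nM; first by rewrite mulr0n mulr0 mass_ge0.
  have ln : 0 <= l *+ n by rewrite mulrn_wge0 // ltW.
  move: nM; rewrite mulrSr mulrDr addrA => nM.
  rewrite (@massD _ X h (h + l *+ n)) //; last by lra.
  apply: lerD; first by apply: IHn; lra.
  apply: le_trans dens _.
  have := mono u v (h + l *+ n - u) u0 ltac:(lra) ltac:(rewrite /l in nM *; lra).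
  have -> : u + (h + l *+ n - u) = h + l *+ n by lra.
  by have -> : v + (h + l *+ n - u) = h + l *+ n + l by rewrite /l; lra.
have Mh : 0 <= M - h by lra.
have /andP[] := truncn_itv (divr_ge0 Mh (ltW l0)); set n := Num.truncn _.
rewrite ler_pdivlMr // ltr_pdivrMr // !mulr_natl mulrSr => sn ns.
have := iter n ltac:(lra).
have := @mass_sub_itv _ X h (h + l *+ n) 0 M mX (ltW h0) ltac:(lra).
have epsM : eps * (l *+ n) <= h.
  apply: le_trans (_ : eps * M <= _); last by rewrite /eps divfK // gt_eqF.
  by rewrite ler_wpM2l ?ltW //; lra.
by rewrite mulrBl mul1r /l in sn ns epsM *; lra.
Qed.

End MonotoneWindows.

Definition slack (R : realType) (DA DB : R) (A B : set R) : R :=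
  rmeas (holes DA A) + (DB - rmeas B).

Lemma slack_gt0 (R : realType) (DA DB : R) (A B : set R) : rmeas B < DB -> 0 < slack DA DB A B.
Proof. by rewrite /slack; have := rmeas_ge0 (holes DA A); lra. Qed.

Section NoRightHole.
Variable R : realType.
Implicit Types (d u v : R).
Variables (DA DB : R) (A B S : set R).
Hypothesis cr : critical DA DB A B S.

Let C := holes DA A.
Let E := holes DB S.
Let M := slack DA DB A B.
Let mB : measurable B := critical_measurableB cr.
Let fC : finmeas C := finmeas_holes DA (critical_measurableA cr).
Let mC : measurable C := proj1 fC.
Let mE : measurable E := measurable_holes DB (critical_measurableS cr).
Let M_ltDB : M < DB.
Proof. by rewrite /M /slack; have := rmeas_holesA_lt cr; rewrite -/C; lra. Qed.

Section LeftHolesUpToSlack.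
Hypothesis M_gt0 : 0 < M.
Hypothesis left_holes_up_to_slack : forall b, 0 <= b < M -> 0 < mass E b M.

Ltac slack_lra := move: M_gt0 M_ltDB; lra.

Lemma left_hole_near_slack d : 0 < d -> exists2 e, E e & 0 <= e /\ M - d < e < M.
Proof.
move=> d0; have bM : 0 <= Num.max 0 (M - d) < M by rewrite le_max lexx gt_max; slack_lra.
have [e Ee] := mass_gt0_ex mE (left_holes_up_to_slack bM); rewrite gt_max => /andP[/andP[e0 ed] eM].
by exists e => //; rewrite (ltW e0) ed.
Qed.

Lemma massB_le_reflection u v : 0 <= u -> v <= M -> mass B u v <= mass C (M - v) (M - u).
Proof.
move=> u0 vM; apply/ler_addgt0Pr => d d0; have [e Ee [e0 ed]] := left_hole_near_slack d0.
have sub w : mass C w (e - u) <= mass C w (M - u) by apply: mass_sub_itv => //; lra.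
have [ve|ev] := leP v e.
  have := left_hole_window cr Ee u0 ve.
  have := @mass_le_trim_left _ C (e - v) (M - v) (e - u) mC ltac:(lra).
  by have := sub (M - v); lra.
have := left_hole_window cr Ee u0 (lexx e); rewrite subrr.
have := @mass_le_trim_right _ B u e v mB (ltW ev).
have := @mass_le_trim_left _ C 0 (M - v) (e - u) mC ltac:(lra).
by have := sub (M - v); lra.
Qed.

Lemma massB_ge_reflection u v : 0 <= u <= v -> v <= M -> mass C (M - v) (M - u) <= mass B u v.
Proof.
move=> uv vM; have := massB_le_reflection (lexx 0) (v := u) ltac:(lra).
have := @massB_le_reflection v M ltac:(lra) (lexx M); rewrite subrr subr0.
have := @massD _ B 0 u M mB ltac:(lra); have := @massD _ B u v M mB ltac:(lra).
have := @massD _ C 0 (M - v) M mC ltac:(lra).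
have := @massD _ C (M - v) (M - u) M mC ltac:(lra).
have := @mass_le_rmeas _ C 0 M fC.
have := @mass_le_trim_right _ B 0 M DB mB (ltW M_ltDB); rewrite (massBE cr) //.
by rewrite /M /slack -/C; lra.
Qed.

Lemma massB_full_up_to_slack : M <= mass B 0 M.
Proof.
apply: monotone_windows_full => // [|h h0].
  apply: mass_window_monotone => // d d0; have [e Ee [e0 ed]] := left_hole_near_slack d0.
  exists (M - e); first lra.
  move=> u v u0 vM; have [uv|vu] := leP u v; last by rewrite !mass_degenerate //; lra.
  have := left_hole_window cr Ee u0 (v := v) ltac:(lra).
  have := @massB_ge_reflection (u + (M - e)) (v + (M - e)) ltac:(lra) vM.
  have -> : M - (v + (M - e)) = e - v by lra.
  have -> : M - (u + (M - e)) = e - u by lra.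
  by move=> CB BC; exact: le_trans BC CB.
pose h' := Num.min h M; have h'0 : 0 < h' by rewrite lt_min h0.
have [h'h h'M] : h' <= h /\ h' <= M by rewrite !ge_min !lexx orbT.
apply: lt_le_trans (mass_sub_itv mB (lexx 0) h'h).
apply: lt_le_trans (massB_ge_reflection (u := 0) _ h'M); last lra.
apply: lt_le_trans (left_holes_up_to_slack (b := M - h') _) _; first lra.
by rewrite subr0; apply: le_mass => // x _; exact: (left_hole_sub cr).
Qed.

End LeftHolesUpToSlack.

Lemma left_hole_free_window : rmeas B < DB -> exists2 b, 0 <= b < M & mass E b M = 0.
Proof.
move=> BD; have M0 : 0 < M := slack_gt0 DA A BD.
apply: contrapT => no_window.
have up_to_slack b : 0 <= b < M -> 0 < mass E b M.
  by move=> bM; rewrite lt_neqAle mass_ge0 andbT; apply/eqP => E0; apply: no_window; exists b.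
have := massB_full_up_to_slack M0 up_to_slack.
have := massB_le_reflection M0 up_to_slack (lexx 0) (lexx M); rewrite subrr subr0.
have ME : M = rmeas C + (DB - rmeas B) by [].
by have := @mass_le_rmeas _ C 0 M fC; lra.
Qed.

End NoRightHole.

(** * The cut points *)

Section Cuts.
Variable R : realType.
Implicit Types (S : set R) (DA DB b c e f : R).
Local Notation mu := (@lebesgue_measure R).

Lemma holes_reflect_at DA DB S :
  holes DB (reflect_at (DA + DB) S) = reflect_at DB (right_holes DA DB S).
Proof.
rewrite /holes /right_holes !reflect_atE; apply/seteqP; split => x /=;
  by rewrite (_ : DA + (DB - x) = DA + DB - x) ?addrA // => -[xD nS]; split => //; lra.
Qed.

Lemma right_holes_reflect_at DA DB S :
  right_holes DA DB (reflect_at (DA + DB) S) = reflect_at DB (holes DB S).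
Proof.
have sE x : DA + DB - (DA + x) = DB - x by lra.
by rewrite /holes /right_holes !reflect_atE; apply/seteqP; split => x /=;
  rewrite sE => -[xD nS]; split => //; lra.
Qed.

Definition cuts DA DB (A B S : set R) b c : Prop :=
  [/\ 0 <= b, 0 <= c, b + c <= slack DA DB A B,
      mu.-negligible [set e | holes DB S e /\ b < e]
    & mu.-negligible [set f | right_holes DA DB S f /\ f < DB - c]].

Variables (DA DB : R) (A B S : set R).
Hypothesis cr : critical DA DB A B S.

Let C := holes DA A.
Let E := holes DB S.
Let F := right_holes DA DB S.
Let M := slack DA DB A B.
Let mA : measurable A := critical_measurableA cr.
Let mB : measurable B := critical_measurableB cr.
Let mC : measurable C := measurable_holes DA mA.
Let mE : measurable E := measurable_holes DB (critical_measurableS cr).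

Ltac diam_lra := move: (critical_leD cr) (critical_DB_gt0 cr); lra.

Lemma cuts_reflect_at b c :
  cuts DA DB (reflect_at DA A) (reflect_at DB B) (reflect_at (DA + DB) S) b c ->
  cuts DA DB A B S c b.
Proof.
rewrite /cuts holes_reflect_at right_holes_reflect_at => -[b0 c0 bc Fb Ec]; split => //.
- move: bc; rewrite addrC /slack (rmeas_holesA cr) (rmeas_holesA (critical_reflect_at cr)).
  by rewrite !rmeas_reflect_at.
- apply: negligibleS (negligible_reflect_at DB Ec) => e [Ee ce].
  by rewrite !reflect_atE /= subKr; split => //; lra.
- apply: negligibleS (negligible_reflect_at DB Fb) => f [Ff fb].
  by rewrite !reflect_atE /= subKr; split => //; lra.
Qed.

Lemma hole_pair_slack e f : 0 <= e -> e <= f <= DB -> mass B 0 e <= mass C 0 e ->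
  mass B f DB <= mass C (f + (DA - DB)) DA -> e + (DB - f) <= M.
Proof.
move=> e0 ef Be Bf; rewrite /M /slack -/C.
have := @massD _ B 0 e DB mB ltac:(lra); have := @massD _ B e f DB mB ltac:(lra).
have := @mass_le _ B e f mB ltac:(lra); have := @massBE _ _ _ _ _ _ cr 0 DB (lexx _) (lexx _).
have := @massD _ C 0 e DA mC ltac:(diam_lra).
have := @massD _ C e (f + (DA - DB)) DA mC ltac:(diam_lra).
have := @mass_holes_whole _ DA A 0 DA (lexx _) (lexx _).
by have := mass_ge0 C e (f + (DA - DB)); lra.
Qed.

Lemma holes_extent : exists b c,
  [/\ 0 <= b, 0 <= c, b + c <= M, forall e, E e -> e <= b & forall f, F f -> DB - c <= f].
Proof.
pose E0 : set R := E `|` [set 0]; pose F0 : set R := reflect_at DB F `|` [set 0].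
have E0_bound e : E0 e -> 0 <= e <= DB /\ mass B 0 e <= mass C 0 e.
  case=> [Ee|->]; first by have [e0 _] := Ee; split; [|exact: (left_hole_mass_le cr Ee)].
  by rewrite !mass_degenerate //; split => //; diam_lra.
have F0_bound x : F0 x -> 0 <= x <= DB /\ mass B (DB - x) DB <= mass C (DB - x + (DA - DB)) DA.
  case=> [|->]; last by rewrite subr0 subrKC !mass_degenerate //; split => //; diam_lra.
  by rewrite reflect_atE => Fx; have [x0 _] := Fx; split; [lra|exact: (right_hole_mass_le cr Fx)].
have sum_le e x : E0 e -> F0 x -> e + x <= M.
  move=> Ee Fx; have [e0 Be] := E0_bound e Ee; have [x0 Bx] := F0_bound x Fx.
  have -> : e + x = e + (DB - (DB - x)) by lra.
  apply: hole_pair_slack => //; first lra.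
  suff : e <= DB - x by lra.
  case: Ee => [Ee|->]; last lra.
  case: Fx => [|->]; last by lra.
  by rewrite reflect_atE => Fx; have := left_holes_lt_right_holes cr Ee Fx; lra.
have E00 : E0 0 by right.
have F00 : F0 0 by right.
have sE : has_sup E0 by split; [exists 0|exists M => e Ee; have := sum_le e 0 Ee F00; lra].
have sF : has_sup F0 by split; [exists 0|exists M => x Fx; have := sum_le 0 x E00 Fx; lra].
exists (sup E0), (sup F0); split.
- exact: (ub_le_sup sE.2 E00).
- exact: (ub_le_sup sF.2 F00).
- rewrite -lerBrDr; apply: (ge_sup sE.1) => e Ee; rewrite lerBrDr addrC -lerBrDr.
  by apply: (ge_sup sF.1) => x Fx; have := sum_le e x Ee Fx; lra.
- by move=> e Ee; apply: (ub_le_sup sE.2); left.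
move=> f Ff; have : DB - f <= sup F0; last by lra.
by apply: (ub_le_sup sF.2); left; rewrite reflect_atE /= subKr.
Qed.

Lemma cuts_of_extent b c : 0 <= b -> 0 <= c -> b + c <= M -> (forall e, E e -> e <= b) ->
  (forall f, F f -> DB - c <= f) -> cuts DA DB A B S b c.
Proof.
move=> b0 c0 bc Eb Fc; split => //; apply: negligible_subset0.
  by move=> e [/Eb]; lra.
by move=> f [/Fc]; lra.
Qed.

Lemma positive_cuts_no_right_hole : rmeas B < DB -> (forall f, F f -> DB <= f) ->
  exists b c, [/\ 0 < b, 0 < c & cuts DA DB A B S b c].
Proof.
move=> BD noF; have M0 : 0 < M := slack_gt0 DA A BD.
have [b] := left_hole_free_window cr BD; rewrite -/M => bM E0.
have E_le e : E e -> e <= M.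
  move=> Ee; have [e0 _] := Ee; have -> : e = e + (DB - DB) by lra.
  apply: hole_pair_slack; [lra|lra|exact: (left_hole_mass_le cr Ee)|].
  by rewrite subrKC !mass_degenerate.
pose b' := Num.max b (M / 2); have bb' : b <= b' by rewrite le_max lexx.
have b'0 : 0 < b' by rewrite lt_max; lra.
have b'M : b' < M by rewrite gt_max; lra.
exists b', (M - b'); split => //; [lra|split; [exact: ltW|lra|by rewrite addrC subrK| |]].
  apply: negligibleS (proj2 (rmeas_negligible (finmeas_mass b M mE)) E0) => e [Ee be].
  by split => //=; rewrite in_itv /= E_le // andbT; lra.
by apply: negligible_subset0 => f [/noF]; lra.
Qed.

End Cuts.

Section Structure.
Variable R : realType.
Implicit Types (Z : set R) (b c x : R).
Local Notation mu := (@lebesgue_measure R).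
Variables (DA DB : R) (A B S : set R).
Hypothesis cr : critical DA DB A B S.

Let C := holes DA A.
Let E := holes DB S.
Let F := right_holes DA DB S.

Lemma critical_cuts :
  exists b c, cuts DA DB A B S b c /\ (rmeas B < DB -> 0 < b /\ 0 < c).
Proof.
have [b [c [b0 c0 bc Eb Fc]]] := holes_extent cr; have cut := cuts_of_extent b0 c0 bc Eb Fc.
have [BD|BD] := ltP (rmeas B) DB; last by exists b, c; split => //; lra.
have [c_le|c_gt] := leP c 0.
  have [f /Fc|b' [c' [b'0 c'0 cut']]] := positive_cuts_no_right_hole cr BD; first lra.
  by exists b', c'.
have [b_le|b_gt] := leP b 0; last by exists b, c.
have BD' : rmeas (reflect_at DB B) < DB.
  by rewrite rmeas_reflect_at //; exact: critical_measurableB cr.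
have [f|b' [c' [b'0 c'0 cut']]] := positive_cuts_no_right_hole (critical_reflect_at cr) BD'.
  by rewrite right_holes_reflect_at reflect_atE => /Eb; lra.
by exists c', b'; split => //; exact: (cuts_reflect_at cr).
Qed.

Variables b c : R.
Hypothesis cut : cuts DA DB A B S b c.

Lemma cuts_bounds : [/\ 0 <= b, 0 <= c & b + c < DB].
Proof.
have [b0 c0 bc _ _] := cut; split => //; apply: le_lt_trans bc _.
by have := rmeas_holesA_lt cr; rewrite /slack; lra.
Qed.

Lemma cuts_in_range : 0 <= b <= DB /\ 0 <= c <= DB.
Proof. by have [b0 c0 bc] := cuts_bounds; split; lra. Qed.

Lemma cuts_length : rmeas A + rmeas B - DB <= DA - c - b.
Proof. by have [_ _ + _ _] := cut; rewrite /slack (rmeas_holesA cr); lra. Qed.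

Let bc_bounds : (0 <= b) && ((0 <= c) && ((b + c < DB) && (DB <= DA))).
Proof. by have [-> -> ->] := cuts_bounds; rewrite (critical_leD cr). Qed.

Ltac cuts_lra := move: bc_bounds; lra.

Lemma cuts_negligible Z : Z `<=` C -> (forall x, Z x -> E x -> b < x) ->
  (forall x, Z x -> F (x - (DA - DB)) -> x < DA - c) -> mu.-negligible Z.
Proof.
move=> ZC ZE ZF; have [_ _ _ Eb Fc] := cut; apply: (critical_negligible cr ZC).
  by apply: negligibleS Eb => x [Zx Ex]; split => //; exact: ZE.
apply: negligibleS (negligible_translate (DA - DB) Fc) => x [Zx].
by rewrite !translateE /= => Fx; split => //; have := ZF x Zx Fx; lra.
Qed.

Lemma cuts_left_stable : mu.-negligible ((S `&` `[0, b]) `\` A).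
Proof.
apply: cuts_negligible => x [[Sx /=]]; rewrite in_itv /= => xb nA.
- by split => //; cuts_lra.
- by case.
- by cuts_lra.
Qed.

Lemma cuts_right_stable :
  mu.-negligible ((S `&` `[DA + DB - c, DA + DB]) `\` translate DB A).
Proof.
have null : mu.-negligible [set x | [/\ S (x + DB), DA - c <= x <= DA & ~ A x]].
  apply: cuts_negligible => x [Sx xc nA].
  - by split => //; cuts_lra.
  - by cuts_lra.
  - by case=> _; rewrite (_ : DA + (x - (DA - DB)) = x + DB) //; lra.
apply: negligibleS (negligible_translate DB null) => x [[Sx /=]].
by rewrite in_itv /= !translateE /= subrK => xc nA; split => //; lra.
Qed.

Lemma cuts_middleA : mu.-negligible (`]b, DA - c[ `\` A).
Proof.
apply: cuts_negligible => x [/=]; rewrite in_itv /= => xbc nA; [|by move=> _; lra..].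
by split => //; cuts_lra.
Qed.

Lemma cuts_middleS : mu.-negligible (`]b, DA + DB - c[ `\` S).
Proof.
have [_ _ _ Eb Fc] := cut.
apply: negligibleS (negligibleU Eb (negligible_translate DA Fc)) => x [/=].
rewrite in_itv translateE /= => xbc nS; have [xD|xD] := leP x DB.
  by left; split; [split => //; cuts_lra|lra].
have xA : DA < x by rewrite ltNge; apply/negP => xA; apply: nS; apply: (critical_middle cr); lra.
by right; split; [split; [cuts_lra|rewrite addrC subrK]|lra].
Qed.

End Structure.

(** * Inner measure *)

Section InnerMeasure.
Variable R : realType.
Implicit Types (X Y Z K N Q : set R) (t u v : R).

Local Notation mu := (@lebesgue_measure R).

Lemma inner_lebesgueE X : finmeas X -> inner_lebesgue X = (rmeas X)%:E.
Proof.
by move=> fX; rewrite -rmeasE // lebesgue_regularity_inner_sup //; case: fX.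
Qed.

Lemma le_inner_lebesgue X Y : X `<=` Y -> (inner_lebesgue X <= inner_lebesgue Y)%E.
Proof.
move=> XY; apply: ge_ereal_sup => _ [K [cK KX] <-].
by apply: ereal_sup_ubound; exists K => //; split => //; exact: subset_trans XY.
Qed.

Lemma inner_lebesgue_ge0 X : (0 <= inner_lebesgue X)%E.
Proof.
rewrite -[0%E](measure0 mu); apply: ereal_sup_ubound; exists set0 => //.
by split => //; exact: compact0.
Qed.

Lemma inner_lebesgue_le X r : (forall K, compact K -> K `<=` X -> rmeas K <= r) ->
  (inner_lebesgue X <= r%:E)%E.
Proof.
move=> Kr; apply: ge_ereal_sup => _ [K [cK KX] <-].
by rewrite rmeasE ?lee_fin; [exact: Kr|exact: finmeas_compact].
Qed.

Lemma inner_lebesgue_image (f : R -> R) X : continuous f ->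
  (forall K, measurable K -> mu (f @` K) = mu K) ->
  (inner_lebesgue X <= inner_lebesgue (f @` X))%E.
Proof.
move=> cf muf; apply: ge_ereal_sup => _ [K [cK KX] <-].
rewrite -muf; last exact: compact_measurable.
apply: ereal_sup_ubound; exists (f @` K) => //; split; last exact: image_subset.
by apply: continuous_compact => //; exact: continuous_subspaceT.
Qed.

Lemma inner_lebesgue_translate t X : inner_lebesgue (translate t X) = inner_lebesgue X.
Proof.
have le s Y : (inner_lebesgue Y <= inner_lebesgue (translate s Y))%E.
  apply: inner_lebesgue_image => [x|K]; last exact: lebesgue_measure_translate.
  by apply: cvgD; [exact: cvg_cst|exact: cvg_id].
apply: le_anti; rewrite le andbT; apply: le_trans (le (- t) _) _.
by rewrite (_ : translate (- t) _ = X) // translateE; apply/seteqP; split => x /=;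
  rewrite translateE /= opprK addrK.
Qed.

Lemma inner_lebesgue_reflect_at t X : inner_lebesgue (reflect_at t X) = inner_lebesgue X.
Proof.
have le Y : (inner_lebesgue Y <= inner_lebesgue (reflect_at t Y))%E.
  apply: inner_lebesgue_image => [x|K]; last exact: lebesgue_measure_reflect_at.
  by apply: cvgB; [exact: cvg_cst|exact: cvg_id].
apply: le_anti; rewrite le andbT; apply: le_trans (le _) _.
by rewrite (_ : reflect_at t _ = X) // reflect_atE; apply/seteqP; split => x /=;
  rewrite reflect_atE /= subKr.
Qed.

Lemma inner_lebesgue_bounded X u v : u <= v -> X `<=` `[u, v] ->
  exists2 r, inner_lebesgue X = r%:E & 0 <= r <= v - u.
Proof.
move=> uv Xuv; have := le_inner_lebesgue Xuv.
rewrite (inner_lebesgueE (finmeas_itv true false u v)) rmeas_itv //.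
have := inner_lebesgue_ge0 X; case: (inner_lebesgue X) => [r| |] //=.
by rewrite !lee_fin => r0 rv; exists r => //; rewrite r0.
Qed.

Definition inner_null Z : Prop := inner_lebesgue Z = 0%E.

Lemma inner_nullP Z :
  inner_null Z <-> forall K, finmeas K -> K `<=` Z -> mu.-negligible K.
Proof.
split=> [Z0 K fK KZ|Znull].
  apply/(rmeas_negligible fK)/le_anti; rewrite rmeas_ge0 andbT -lee_fin -inner_lebesgueE //.
  by rewrite -[leRHS]Z0; exact: le_inner_lebesgue.
apply: le_anti; rewrite inner_lebesgue_ge0 andbT; apply: inner_lebesgue_le => K cK KZ.
have fK := finmeas_compact cK.
by rewrite (proj1 (rmeas_negligible fK)) //; exact: Znull.
Qed.

Lemma inner_null_absorb Y Z N : inner_null Y -> mu.-negligible N -> Z `<=` Y `|` N ->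
  inner_null Z.
Proof.
move=> /inner_nullP Y0 [M [mM M0 NM]] ZYN; apply/inner_nullP => K fK KZ.
have nM : mu.-negligible M by apply/negligibleP.
apply: negligibleS (negligibleU (Y0 (K `\` M) _ _) nM).
- by move=> x Kx; have [Mx|nMx] := pselect (M x); [right|left].
- by measurability.
- by move=> x [/KZ/ZYN[//|/NM]].
Qed.

Lemma inner_nullS Y Z : Z `<=` Y -> inner_null Y -> inner_null Z.
Proof.
move=> ZY Y0; apply: (inner_null_absorb Y0 (negligible_set0 _)).
by rewrite setU0.
Qed.

Lemma inner_null_set0 : inner_null set0.
Proof. by apply/inner_nullP => K _ /negligible_subset0. Qed.

Lemma negligible_inner_null N : mu.-negligible N -> inner_null N.
Proof.
by move=> N0; apply: (inner_null_absorb inner_null_set0 N0); rewrite set0U.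
Qed.

Lemma inner_null_split Q Z : measurable Q -> inner_null (Z `&` Q) -> inner_null (Z `\` Q) ->
  inner_null Z.
Proof.
move=> mQ /inner_nullP ZQ /inner_nullP ZnQ; apply/inner_nullP => K fK KZ.
rewrite -(setUIDK K Q); apply: negligibleU; [apply: ZQ|apply: ZnQ]; try by measurability.
- by move=> x [/KZ].
- by move=> x [/KZ].
Qed.

Lemma inner_null_translate t Z : inner_null Z -> inner_null (translate t Z).
Proof. by rewrite /inner_null inner_lebesgue_translate. Qed.

Lemma null_subW X Y : X `<=` Y -> null_sub X Y.
Proof. by rewrite -setD_eq0 /null_sub => ->; exact: inner_null_set0. Qed.

Definition measurable_version X X0 : Prop :=
  [/\ finmeas X0, mu.-negligible (X0 `\` X) & null_sub X X0].

Lemma inner_lebesgue_version X X0 Q : measurable Q -> measurable_version X X0 ->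
  inner_lebesgue (X `&` Q) = (rmeas (X0 `&` Q))%:E.
Proof.
move=> mQ [f0 [N [mN N0 X0N]] /inner_nullP XX0]; have m0 := proj1 f0.
have nN : mu.-negligible N by apply/negligibleP.
apply: le_anti; apply/andP; split.
  apply: inner_lebesgue_le => K cK KX; have fK := finmeas_compact cK.
  apply: le_rmeas_ae; [by case: fK|by measurability|apply: XX0; first by measurability].
  by move=> x [/KX[Xx Qx] nX]; split => // X0x; apply: nX.
have -> : rmeas (X0 `&` Q) = rmeas ((X0 `&` Q) `\` N).
  apply: eq_rmeas_ae; [by measurability|by measurability| |].
    by apply: negligibleS nN => x [X0Q nX]; apply: contrapT => nNx; apply: nX.
  by apply: negligible_subset0 => x [[X0Q _] nX0Q]; exact: nX0Q.
rewrite -inner_lebesgueE; last by measurability.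
apply: le_inner_lebesgue => x [[X0x Qx] nNx]; split => //.
by apply: contrapT => nX; apply/nNx/X0N.
Qed.

Lemma measurable_version_inner X X0 : measurable_version X X0 ->
  inner_lebesgue X = (rmeas X0)%:E.
Proof. by move/(inner_lebesgue_version measurableT); rewrite !setIT. Qed.

Lemma measurable_version_sub X X0 : finmeas X0 -> X0 `<=` X ->
  (inner_lebesgue X <= (rmeas X0)%:E)%E -> measurable_version X X0.
Proof.
move=> f0 X0X XE; split => //.
  by apply: negligible_subset0; rewrite subset0 setD_eq0.
apply/inner_nullP => K fK KX; apply/(rmeas_negligible fK)/le_anti; rewrite rmeas_ge0 andbT.
rewrite -(lerD2l (rmeas X0)) addr0 -rmeasU //; last by move=> x [X0x /KX[]].
rewrite -lee_fin; apply: le_trans XE; rewrite -inner_lebesgueE; last by measurability.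
by apply: le_inner_lebesgue => x [/X0X|/KX[]].
Qed.

Lemma measurable_version_reflect_at t X X0 : measurable_version X X0 ->
  measurable_version (reflect_at t X) (reflect_at t X0).
Proof.
have reflectD Y Z : reflect_at t Y `\` reflect_at t Z = reflect_at t (Y `\` Z).
  by rewrite !reflect_atE.
move=> [[m0 f0] X0X XX0]; split; first by split;
  [exact: measurable_reflect_at|rewrite lebesgue_measure_reflect_at].
- by rewrite reflectD; exact: negligible_reflect_at.
- by rewrite /null_sub reflectD inner_lebesgue_reflect_at.
Qed.

Lemma measurable_version_ae X X0 X1 : finmeas X1 -> X0 `<=` X1 -> mu.-negligible (X1 `\` X0) ->
  measurable_version X X0 -> measurable_version X X1.
Proof.
move=> f1 X01 X10 [f0 X0X XX0]; split => //; last by apply: inner_nullS XX0; exact: setDS.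
apply: negligibleS (negligibleU X10 X0X) => x [X1x nX].
by have [X0x|nX0] := pselect (X0 x); [right|left].
Qed.

End InnerMeasure.

(** * Reduction to measurable sets containing their end points *)

Section Reduction.
Variable R : realType.
Implicit Types (A B X Y S : set R) (D DA DB e s t x : R).

Local Notation mu := (@lebesgue_measure R).

Definition sigma_compact X : Prop :=
  exists2 K : nat -> set R, (forall n, compact (K n)) & X = \bigcup_n K n.

Lemma sigma_compact_measurable X : sigma_compact X -> measurable X.
Proof.
by move=> [K cK ->]; apply: bigcup_measurable => n _; exact: compact_measurable.
Qed.

Lemma sigma_compactU X Y : sigma_compact X -> compact Y -> sigma_compact (X `|` Y).
Proof.
move=> [K cK ->] cY; exists (fun n => K n `|` Y); first by move=> n; exact: compactU.
by rewrite bigcupUl //; exists 0%N.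
Qed.

Lemma measurable_sumset X Y : sigma_compact X -> sigma_compact Y -> measurable (sumset X Y).
Proof.
move=> [K cK ->] [L cL ->].
have -> : sumset (\bigcup_n K n) (\bigcup_n L n) = \bigcup_i \bigcup_j sumset (K i) (L j).
  apply/seteqP; split => x.
    case=> a [i _ Ka] [b [j _ Lb]] <-; exists i => //; exists j => //.
    by exists a => //; exists b.
  by case=> i _ [j _ [a Ka [b Lb <-]]]; exists a; [exists i|exists b => //; exists j].
apply: bigcup_measurable => i _; apply: bigcup_measurable => j _.
by apply: compact_measurable; exact: compact_sumset.
Qed.

(* A compact part of [X] outside [S] and a small translate of it inside [S] would both fit into
   an open set of less than twice its measure. *)
Lemma small_translates_negligible X S : finmeas X -> measurable S ->
  (forall e, 0 < e -> exists2 t, `|t| < e & translate t X `<=` S) ->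
  mu.-negligible (X `\` S).
Proof.
move=> fX mS small; have fY : finmeas (X `\` S) by measurability.
apply/(rmeas_negligible fY)/le_anti; rewrite rmeas_ge0 andbT leNgt; apply/negP => pos.
have [K [cK KY Km]] := rmeas_inner fY pos.
have fK := finmeas_compact cK; have K0 : 0 < rmeas K by move: Km; rewrite ltrDr.
have [U [oU KU fUK Ue]] := rmeas_outer fK K0.
have [d d0 dU] := compact_uniform_nbhs cK oU KU.
have [t td tS] := small d d0.
have : rmeas K <= rmeas (U `\` K).
  rewrite -(rmeas_translate t (X := K)); last by measurability.
  apply: le_rmeas => //; first by measurability.
  move=> _ [x Kx <-]; split.
    by apply: (dU x Kx); rewrite /ball /= opprD addrCA subrr addr0 normrN.
  by move=> /KY[_]; apply; apply: tS; exists x => //; have [] := KY _ Kx.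
lra.
Qed.

Definition spans D X : Prop :=
  X `<=` `[0, D] /\ forall e, 0 < e -> (exists2 x, X x & x < e) /\ (exists2 x, X x & D - e < x).

Lemma spans_compact_subset D X e : 0 <= D -> spans D X -> 0 < e ->
  exists K : set R, [/\ compact K, K `<=` X, (inner_lebesgue X < (rmeas K + e)%:E)%E,
    exists2 x, K x & x < e & exists2 x, K x & D - e < x].
Proof.
move=> D0 [XD Xe] e0; have [r Xr _] := inner_lebesgue_bounded D0 XD.
have [_ [K [cK KX] <-]] : exists2 y,
    [set mu K | K in [set K | compact K /\ K `<=` X]] y & ((r - e)%:E < y)%E.
  by apply: ereal_sup_gt; rewrite -/(inner_lebesgue X) Xr lte_fin; lra.
rewrite (rmeasE (finmeas_compact cK)) lte_fin => Kr; have [[x Xx xe] [y Xy ye]] := Xe _ e0.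
have cKxy : compact (K `|` [set x; y]).
  by apply: compactU => //; apply: compactU; exact: compact_set1.
exists (K `|` [set x; y]); split => //.
- by move=> z [/KX|[->|->]].
- rewrite Xr lte_fin; suff : rmeas K <= rmeas (K `|` [set x; y]) by lra.
  apply: le_rmeas; [exact: compact_measurable|exact: finmeas_compact|exact: subsetUl].
- by exists x => //; right; left.
- by exists y => //; right; right.
Qed.

Lemma spans_sigma_compact_core D X : 0 <= D -> spans D X ->
  exists X0 : set R, [/\ sigma_compact X0, X0 `<=` X, measurable_version X X0 & spans D X0].
Proof.
move=> D0 spX; have inv n : 0 < n.+1%:R^-1 :> R by rewrite invr_gt0.
have [K HK] := choice (fun n => spans_compact_subset D0 spX (inv n)).
pose X0 := \bigcup_n K n.
have KX0 n : K n `<=` X0 by move=> x Kx; exists n.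
have X0X : X0 `<=` X by move=> x [n _]; have [_ KX _ _ _] := HK n; exact: KX.
have scX0 : sigma_compact X0 by exists K => // n; have [] := HK n.
have fX0 : finmeas X0.
  apply: finmeas_sub (finmeas_itv true false 0 D) (subset_trans X0X spX.1).
  exact: sigma_compact_measurable.
have small e : 0 < e -> exists n : nat, n.+1%:R^-1 < e.
  move=> e0; exists (Num.truncn e^-1); have ei : 0 <= e^-1 by rewrite invr_ge0 ltW.
  by rewrite invf_plt ?posrE //; have /andP[] := truncn_itv ei.
exists X0; split => //; last first.
  split; first exact: subset_trans X0X spX.1.
  move=> e /small[n ne]; have [_ _ _ [x Kx xn] [y Ky yn]] := HK n.
  split; [exists x|exists y]; [exact: KX0 Kx|exact: lt_trans xn ne|exact: KX0 Ky|].
  by apply: lt_trans yn; rewrite ltrD2l ltrN2.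
apply: measurable_version_sub => //; have [r Xr _] := inner_lebesgue_bounded D0 spX.1.
rewrite Xr lee_fin; apply/ler_addgt0Pr => e /small[n ne]; have [cK _ + _ _] := HK n.
rewrite Xr lte_fin => Kr; suff KX : rmeas (K n) <= rmeas X0.
  by apply: le_trans (ltW Kr) _; rewrite lerD // ltW.
by apply: le_rmeas => //; exact: compact_measurable.
Qed.

Definition ends D : set R := [set 0; D].

Lemma negligible_ends D : mu.-negligible (ends D).
Proof. by apply: negligibleU; exact: negligible_set1. Qed.

Lemma compact_ends D : compact (ends D).
Proof. by apply: compactU; exact: compact_set1. Qed.

Lemma finmeas_setU_ends X D : finmeas X -> finmeas (X `|` ends D).
Proof. by move=> fX; apply: finmeasU => //; exact/finmeas_compact/compact_ends. Qed.

Lemma rmeas_setU_ends X D : finmeas X -> rmeas (X `|` ends D) = rmeas X.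
Proof.
move=> fX; apply: eq_rmeas_ae => //; first exact: finmeas_setU_ends.
  by apply: negligibleS (negligible_ends D) => x [[]].
by apply: negligible_subset0 => x [Xx]; apply; left.
Qed.

Lemma measurable_version_setU_ends X X0 D : measurable_version X X0 ->
  measurable_version X (X0 `|` ends D).
Proof.
move=> vX; have [f0 _ _] := vX; apply: measurable_version_ae vX.
- exact: finmeas_setU_ends.
- by move=> x; left.
- by apply: negligibleS (negligible_ends D) => x [[]].
Qed.

Lemma spans_translate_negligible D X Y S s : finmeas X -> spans D Y -> sumset X Y `<=` S ->
  measurable S -> ends D s -> mu.-negligible (translate s X `\` S).
Proof.
move=> fX [YD Ye] XYS mS sD; apply: small_translates_negligible => //; first by measurability.
move=> e e0; suff [y Yy ye] : exists2 y, Y y & `|y - s| < e.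
  exists (y - s) => // _ [_ [x Xx <-] <-]; apply: XYS; exists x => //; exists y => //.
  by lra.
have [[y Yy y1] [z Yz z1]] := Ye e e0; have := YD _ Yy; have := YD _ Yz.
rewrite /= !in_itv /= => z2 y2.
by case: sD => ->; [exists y|exists z] => //; rewrite ltr_norml; lra.
Qed.

Lemma sumset_ends_negligible A B DA DB : finmeas A -> finmeas B -> measurable (sumset A B) ->
  spans DA A -> spans DB B ->
  mu.-negligible (sumset (A `|` ends DA) (B `|` ends DB) `\` sumset A B).
Proof.
move=> fA fB mS spA spB.
have nA s : ends DB s -> mu.-negligible (translate s A `\` sumset A B).
  exact: (spans_translate_negligible fA spB).
have nB s : ends DA s -> mu.-negligible (translate s B `\` sumset A B).
  apply: (spans_translate_negligible fB spA) => //.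
  by move=> _ [b Bb [a Aa <-]]; exists a => //; exists b => //; rewrite addrC.
have e0 D : ends D 0 by left.
have eD D : ends D D by right.
have nE : mu.-negligible (ends DB `|` translate DA (ends DB)).
  by apply: negligibleU; [|apply: negligible_translate]; exact: negligible_ends.
apply: negligibleS (negligibleU (negligibleU (nA 0 (e0 _)) (nA DB (eD _)))
  (negligibleU (negligibleU (nB 0 (e0 _)) (nB DA (eD _))) nE)).
move=> _ [[a [Aa|[->|->]] [b [Bb|Eb] <-]]] nS.
- by case: nS; exists a => //; exists b.
- by left; case: Eb nS => -> nS; [left|right]; split => //; exists a; rewrite // addrC.
- by right; left; left; split => //; exists b.
- by right; right; left; rewrite add0r.
- by right; left; right; split => //; exists b.
- by right; right; right; exists b.
Qed.

Lemma critical_version A B DA DB : 0 <= DB -> DB <= DA -> spans DA A -> spans DB B ->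
  inner_lebesgue (sumset A B) = (DB%:E + inner_lebesgue A)%E ->
  (DB%:E + inner_lebesgue A < inner_lebesgue A + 2%:E * inner_lebesgue B)%E ->
  exists A1 B1 S1 : set R, [/\ measurable_version A A1, measurable_version B B1,
    measurable_version (sumset A B) S1 & critical DA DB A1 B1 S1].
Proof.
move=> DB0 D spA spB; have DA0 : 0 <= DA by lra.
have [A0 [scA AA vA spA0]] := spans_sigma_compact_core DA0 spA.
have [B0 [scB BB vB spB0]] := spans_sigma_compact_core DB0 spB.
rewrite (measurable_version_inner vA) (measurable_version_inner vB) -EFinM -!EFinD lte_fin.
have [[fA _ _] [fB _ _]] := (vA, vB) => SE large.
pose A1 := A0 `|` ends DA; pose B1 := B0 `|` ends DB; pose S1 := sumset A1 B1.
have mS0 := measurable_sumset scA scB.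
have mS1 : measurable S1.
  by apply: measurable_sumset; apply: sigma_compactU => //; exact: compact_ends.
have endsD D' : 0 <= D' -> ends D' `<=` `[0, D'].
  by move=> D'0 x [|] ->; rewrite /= in_itv /= ?lexx ?D'0.
have A1D : A1 `<=` `[0, DA] by move=> x [/spA0.1//|]; exact: endsD.
have B1D : B1 `<=` `[0, DB] by move=> x [/spB0.1//|]; exact: endsD.
have S1D : S1 `<=` `[0, DA + DB].
  by move=> _ [a /A1D + [b /B1D + <-]]; rewrite /= !in_itv /=; lra.
have fS1 := finmeas_sub mS1 (finmeas_itv true false 0 (DA + DB)) S1D.
have S01 : sumset A0 B0 `<=` S1.
  by move=> _ [a Aa [b Bb <-]]; exists a; [left|exists b => //; left].
have fS0 := finmeas_sub mS0 fS1 S01.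
have S10 := sumset_ends_negligible fA fB mS0 spA0 spB0.
have S0S : sumset A0 B0 `<=` sumset A B.
  by move=> _ [a /AA Aa [b /BB Bb <-]]; exists a => //; exists b.
have S1_le : rmeas S1 <= rmeas (sumset A0 B0) by exact: le_rmeas_ae.
have S0_le : rmeas (sumset A0 B0) <= DB + rmeas A0.
  by rewrite -lee_fin -SE -inner_lebesgueE //; exact: le_inner_lebesgue.
have cr : critical DA DB A1 B1 S1.
  split => //; try by [left|right; left|right; right].
  - exact: proj1 (finmeas_setU_ends DA fA).
  - exact: proj1 (finmeas_setU_ends DB fB).
  - by move=> a b Aa Bb; exists a => //; exists b.
  - by rewrite rmeas_setU_ends // addrC (le_trans S1_le).
  - by rewrite rmeas_setU_ends //; lra.
exists A1, B1, S1; split => //; try exact: measurable_version_setU_ends.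
apply: (measurable_version_ae fS1 S01 S10); apply: measurable_version_sub => //.
rewrite SE lee_fin; have := proj1 (critical_equality cr).
by rewrite rmeas_setU_ends //; lra.
Qed.

End Reduction.

Section HalfRadius.
Variable R : realType.
Implicit Types (A B S X : set R) (D DA DB x : R).

Definition half_radius D X : R := sup [set x | 0 <= x <= D /\ mass X 0 x <= x / 2].

Lemma half_radius_attained D X : measurable X -> 0 < half_radius D X ->
  half_radius D X <= D /\ mass X 0 (half_radius D X) <= half_radius D X / 2.
Proof.
rewrite /half_radius; set H := [set x | _] => mX c0.
have [H0|/nonemptyPn H0] := pselect (H !=set0); last by move: c0; rewrite H0 sup0 ltxx.
have sH : has_sup H by split => //; exists D => x [/andP[]].
split; first by apply: (ge_sup sH.1) => x [/andP[]].
apply/ler_addgt0Pr => e e0; have [x [xD Hx] xe] := sup_adherent e0 sH.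
have xc : x <= sup H by apply: (ub_le_sup sH.2).
by have := @mass_le_trim_right _ X 0 x (sup H) mX xc; lra.
Qed.

Lemma half_radius_bound DA DB A B S x : critical DA DB A B S -> 0 < x <= half_radius DA A ->
  mass B 0 x <= x ^+ 2 / half_radius DA A.
Proof.
move=> cr xc; have c0 : 0 < half_radius DA A by lra.
have [cD Ac] := half_radius_attained (critical_measurableA cr) c0.
exact: (half_density_bound cr c0 cD Ac xc).
Qed.

Lemma left_half_radiusE D X X0 : measurable_version X X0 ->
  left_half_radius D X = half_radius D X0.
Proof.
move=> vX; congr sup; apply/seteqP; split => x /= [xD];
  by rewrite (inner_lebesgue_version _ vX) // lee_fin.
Qed.

Lemma right_half_radiusE D X X0 : measurable_version X X0 ->
  right_half_radius D X = half_radius D (reflect_at D X0).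
Proof.
move=> vX; have [[mX0 _] _ _] := vX; congr sup; apply/seteqP; split => x /= [xD];
  by rewrite (inner_lebesgue_version _ vX) // rmeasI_itv_oo // mass_reflect_at // subr0 lee_fin.
Qed.

End HalfRadius.

(** * Structure of the sumset *)

Section SumsetStructure.
Variable R : realType.
Implicit Types (s t x : R) (X : set R).
Local Notation mu := (@lebesgue_measure R).

Lemma reflect_at_reflect_at s t X : reflect_at t (reflect_at s X) = translate (t - s) X.
Proof.
rewrite !reflect_atE translateE; apply/seteqP; split => x /=;
  by rewrite (_ : s - (t - x) = x - (t - s)) //; lra.
Qed.

Lemma translate0 X : translate 0 X = X.
Proof. by rewrite translateE; apply/seteqP; split => x /=; rewrite subr0. Qed.

Variables (DA DB : R) (A B A1 B1 S : set R) (b c : R).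
Let AB := sumset A B.
Hypotheses (subA : A `<=` `[0, DA]) (subB : B `<=` `[0, DB]).
Hypotheses (vA : measurable_version A A1) (vB : measurable_version B B1).
Hypothesis vS : measurable_version AB S.
Hypothesis cr : critical DA DB A1 B1 S.
Hypothesis cut : cuts DA DB A1 B1 S b c.

Let I : set R := `]b, DA - c[%classic.
Let J : set R := `]b, DA + DB - c[%classic.
Let top : set R := `[DA + DB - c, DA + DB]%classic.
Let T : set R := translate DB (A `&` `[DA - c, DA]).

Let bounds : [&& 0 <= b, 0 <= c, b + c < DB & DB <= DA].
Proof. by have [-> -> ->] := cuts_bounds cr cut; rewrite (critical_leD cr). Qed.

Ltac cuts_lra := move: bounds; lra.

Let subAB : AB `<=` `[0, DA + DB].
Proof. by move=> _ [x /subA + [y /subB + <-]]; rewrite /= !in_itv /=; lra. Qed.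

Let T_sub_top : T `<=` top.
Proof. by rewrite /T translateE => x [_]; rewrite /top /= !in_itv /=; lra. Qed.

Lemma left_stable_version : mu.-negligible ((S `&` `[0, b]) `\` A).
Proof.
have [_ A1A _] := vA; apply: negligibleS (negligibleU (cuts_left_stable cr cut) A1A).
by move=> x [Sx nA]; have [?|?] := pselect (A1 x); [right|left].
Qed.

Lemma right_stable_version : mu.-negligible ((S `&` top) `\` translate DB A).
Proof.
have [_ A1A _] := vA.
apply: negligibleS (negligibleU (cuts_right_stable cr cut) (negligible_translate DB A1A)).
rewrite !translateE => x [Sx nA]; have [?|?] := pselect (A1 (x - DB)); [right|left] => //.
Qed.

Lemma summand_null_sub_sumset : null_sub A AB.
Proof.
have [_ SAB _] := vS; have [_ _ AA1] := vA; apply: (inner_null_absorb AA1 SAB) => x [Ax nAB].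
have [A1x|nA1] := pselect (A1 x); [right; split => //|by left].
by rewrite -[x]addr0; exact: critical_sum cr _ _ A1x (critical_minB cr).
Qed.

Lemma summand_translate_null_sub_sumset : null_sub (translate DB A) AB.
Proof.
have [_ SAB _] := vS; have [_ _ AA1] := vA.
apply: (inner_null_absorb (inner_null_translate DB AA1) SAB); rewrite !translateE => x [Ax nAB].
have [A1x|nA1] := pselect (A1 (x - DB)); [right; split => //|by left].
by rewrite -(subrK DB x); exact: critical_sum cr _ _ A1x (critical_maxB cr).
Qed.

Lemma middle_null_sub_summand : null_sub I A.
Proof.
have [_ A1A _] := vA; apply: negligible_inner_null.
apply: negligibleS (negligibleU (cuts_middleA cr cut) A1A) => x [Ix nA].
by have [?|?] := pselect (A1 x); [right|left].
Qed.

Lemma middle_null_sub_sumset : null_sub J AB.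
Proof.
have [_ SAB _] := vS; apply: negligible_inner_null.
apply: negligibleS (negligibleU (cuts_middleS cr cut) SAB) => x [Jx nAB].
by have [?|?] := pselect (S x); [right|left].
Qed.

Lemma left_parts_null_eq : null_eq (A `&` `[0, b]) (AB `&` `[0, b]).
Proof.
have [_ _ ABS] := vS; split.
  by apply: inner_nullS summand_null_sub_sumset => x [[Ax xb] nAB]; split => // ABx; apply: nAB.
apply: (inner_null_absorb ABS left_stable_version) => x [[ABx xb] nA].
by have [Sx|nS] := pselect (S x); [right; split => // Ax; apply: nA|left].
Qed.

Lemma right_parts_null_eq : null_eq (AB `&` top) T.
Proof.
have [_ _ ABS] := vS; split.
  apply: (inner_null_absorb ABS right_stable_version) => x [[ABx xt] nT].
  have [Sx|nS] := pselect (S x); [right|by left].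
  split => //; move: nT xt; rewrite /T !translateE /top /= !in_itv /= => nT xt Ax.
  by apply: nT; split => //; lra.
apply: inner_nullS summand_translate_null_sub_sumset => x [Tx nAB]; split.
  by move: Tx; rewrite /T !translateE => -[].
by move=> ABx; apply: nAB; split => //; exact: T_sub_top.
Qed.

Lemma summandA_decomposition : null_eq A (A `&` `[0, b] `|` I `|` A `&` `[DA - c, DA]).
Proof.
split; last by apply: inner_nullS middle_null_sub_summand => x [[[[//]|Ix]|[//]] nA].
apply: null_subW => x Ax; have := subA Ax; rewrite /I /= !in_itv /= => xD.
have [xb|xb] := leP x b; first by left; left; split => //; lra.
by have [xc|xc] := ltP x (DA - c); [left; right; lra|right; split => //; lra].
Qed.

Lemma sumset_decomposition : null_eq AB (A `&` `[0, b] `|` J `|` T).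
Proof.
split.
  apply: (@inner_null_split _ `[0, b]%classic) => //.
    apply: inner_nullS (proj2 left_parts_null_eq) => x [[ABx nU] xb]; split => // Ax.
    by apply: nU; left; left.
  apply: inner_nullS (proj1 right_parts_null_eq) => x [[ABx nU] nb].
  split; last by move=> Tx; apply: nU; right.
  have := subAB ABx; rewrite /top /= !in_itv /= => xD; split => //.
  have [xb|xb] := leP x b; first by case: nb; rewrite /= in_itv /=; lra.
  have [xc|xc] := ltP x (DA + DB - c); last lra.
  by case: nU; left; right; rewrite /J /= in_itv /= xb.
apply: (@inner_null_split _ `[0, b]%classic) => //.
  apply: inner_nullS (proj1 left_parts_null_eq) => x [[[[Ax|Jx]|/T_sub_top Tx] nAB] xb].
  - by split => // -[].
  - by move: Jx xb; rewrite /J /= !in_itv /=; lra.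
  - by move: Tx xb; rewrite /top /= !in_itv /=; cuts_lra.
apply: (@inner_null_split _ J) => //; first exact: measurable_itv.
  by apply: inner_nullS middle_null_sub_sumset => x [[[_ nAB] _] Jx].
apply: inner_nullS (proj2 right_parts_null_eq) => x [[[[[[_ xb]|Jx]|Tx] nAB] nb] nJ] //.
by split => // -[].
Qed.

Lemma left_density_bound x : 0 < x <= left_half_radius DA A ->
  (inner_lebesgue (B `&` `[0%R, x]) <= (x ^+ 2 / left_half_radius DA A)%:E)%E.
Proof.
rewrite (left_half_radiusE DA vA) (inner_lebesgue_version _ vB) // lee_fin.
exact: half_radius_bound cr.
Qed.

Lemma right_density_bound x : 0 < x <= right_half_radius DA A ->
  (inner_lebesgue (reflect_at DB B `&` `[0%R, x]) <= (x ^+ 2 / right_half_radius DA A)%:E)%E.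
Proof.
rewrite (right_half_radiusE DA vA).
rewrite (inner_lebesgue_version _ (measurable_version_reflect_at DB vB)) // lee_fin.
exact: half_radius_bound (critical_reflect_at cr).
Qed.

Let left_part : set R := B `&` A `&` `[0, b].
Let middle_part : set R := B `&` `]b, DB - c[.
Let right_part : set R := B `&` translate (DB - DA) A `&` `[DB - c, DB].

Lemma summandB_decomposition : null_eq B (left_part `|` middle_part `|` right_part).
Proof.
have [_ _ BB1] := vB; split; last by apply: null_subW => x [[[[Bx _] _]|[Bx _]]|[[Bx _] _]].
apply: (inner_null_absorb BB1 (negligibleU left_stable_version
  (negligible_translate (- DA) right_stable_version))) => x [Bx nU].
have [B1x|nB1] := pselect (B1 x); [right|by left].
have := subB Bx; rewrite /= in_itv /= => xD.
have [xb|xb] := leP x b.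
  left; split; first by split; [exact: critical_B_subS cr _ B1x|rewrite /= in_itv /=; lra].
  by move=> Ax; apply: nU; left; left; split => //=; rewrite in_itv /=; lra.
have [xc|xc] := ltP x (DB - c).
  by case: nU; left; right; split => //=; rewrite in_itv /= xb.
right; rewrite translateE /= opprK addrC; split.
  by split; [exact: critical_translateB_subS cr _ B1x|rewrite /top /= in_itv /=; lra].
rewrite translateE /= => Ax; apply: nU; right; split; last by rewrite /= in_itv /=; lra.
by split => //; rewrite translateE /= (_ : x - (DB - DA) = DA + x - DB) //; lra.
Qed.

Lemma summand_parts : exists B_left B_middle B_right : set R,
  [/\ null_eq B (B_left `|` B_middle `|` reflect_at DB B_right),
      [/\ B_left `&` B_middle = set0, B_left `&` reflect_at DB B_right = set0
        & B_middle `&` reflect_at DB B_right = set0],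
      [/\ B_left `<=` A `&` `[0, b], B_right `<=` reflect_at DA (A `&` `[DA - c, DA])
        & B_middle `<=` `]b, DB - c[],
      forall x, 0 < x <= left_half_radius DA A ->
        (inner_lebesgue (B_left `&` `[0%R, x]) <= (x ^+ 2 / left_half_radius DA A)%:E)%E
    & forall x, 0 < x <= right_half_radius DA A ->
        (inner_lebesgue (B_right `&` `[0%R, x]) <= (x ^+ 2 / right_half_radius DA A)%:E)%E].
Proof.
exists left_part, middle_part, (reflect_at DB right_part).
rewrite reflect_at_reflect_at subrr translate0; split.
- exact: summandB_decomposition.
- by split; rewrite -subset0 => x [[_ /=] + [_ /=]]; rewrite !in_itv /=; cuts_lra.
- split; [by move=> x [[_ Ax] xb]| |by move=> x []].
  rewrite !reflect_atE /right_part translateE => x [[_ /=]]; rewrite in_itv /= => Ax xc.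
  split; last by rewrite /= in_itv /=; lra.
  by rewrite (_ : DA - x = DB - x - (DB - DA)) //; lra.
- move=> x xc; apply: le_trans (left_density_bound xc); apply: le_inner_lebesgue.
  by apply: setSI => y [[]].
move=> x xc; apply: le_trans (right_density_bound xc); apply: le_inner_lebesgue.
by apply: setSI; rewrite !reflect_atE => y [[]].
Qed.

End SumsetStructure.

Section Normalization.
Variable R : realType.
Implicit Types (A B X Y : set R) (s t : R).

Lemma bounded_has_sup_inf X : bounded_set X -> X !=set0 -> has_sup X /\ has_inf X.
Proof.
move=> [M [_ MX]] X0; have {}MX x : X x -> `|x| <= M + 1 by apply: MX; rewrite ltrDl.
by split; split => //; [exists (M + 1)|exists (- (M + 1))] => x /MX; rewrite ler_norml => /andP[].
Qed.

Lemma spans_translate_inf X : bounded_set X -> X !=set0 ->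
  spans (diam X) (translate (- inf X) X).
Proof.
move=> bX X0; have [sX iX] := bounded_has_sup_inf bX X0.
rewrite /diam; split=> [_ [x Xx <-]|e e0].
  by rewrite /= in_itv /=; have := ub_le_sup sX.2 Xx; have := ge_inf iX.2 Xx; lra.
have [x Xx xe] := inf_adherent e0 iX; have [y Xy ye] := sup_adherent e0 sX.
by split; [exists (- inf X + x)|exists (- inf X + y)]; [exists x|lra|exists y|lra].
Qed.

Lemma spans_ge0 D X : spans D X -> 0 <= D.
Proof.
by move=> [XD /(_ 1 ltr01)[[x Xx _] _]]; have := XD x Xx; rewrite /= in_itv /=; lra.
Qed.

Lemma sumset_translate s t X Y :
  sumset (translate s X) (translate t Y) = translate (s + t) (sumset X Y).
Proof.
apply/seteqP; split => z.
  case=> _ [x Xx <-] [_ [y Yy <-] <-]; exists (x + y); last by rewrite addrACA.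
  by exists x => //; exists y.
case=> _ [x Xx [y Yy <-]] <-; exists (s + x); first by exists x.
by exists (t + y); [exists y|rewrite addrACA].
Qed.

Lemma diam_set0 : diam (set0 : set R) = 0.
Proof. by rewrite /diam sup0 inf0 subrr. Qed.

Lemma critical_nonempty A B : bounded_set B -> diam B <= diam A ->
  ((diam B)%:E + inner_lebesgue A < inner_lebesgue A + 2%:E * inner_lebesgue B)%E ->
  A !=set0 /\ B !=set0.
Proof.
move=> bB hD; have inner0 : inner_lebesgue (set0 : set R) = 0%E by exact: inner_null_set0.
have [->|/set0P B0] := eqVneq B set0; first by rewrite diam_set0 inner0 mule0 adde0 add0e ltxx.
have [AE|/set0P//] := eqVneq A set0; move: hD; rewrite AE diam_set0 inner0 adde0 add0e => DB.
have spB := spans_translate_inf bB B0.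
have [r Br r0] := inner_lebesgue_bounded (spans_ge0 spB) spB.1.
by rewrite -(inner_lebesgue_translate (- inf B) B) Br -EFinM lte_fin; lra.
Qed.

Lemma critical_version_translate_inf A B : bounded_set A -> bounded_set B -> diam B <= diam A ->
  inner_lebesgue (sumset A B) = ((diam B)%:E + inner_lebesgue A)%E ->
  ((diam B)%:E + inner_lebesgue A < inner_lebesgue A + 2%:E * inner_lebesgue B)%E ->
  let A' := translate (- inf A) A in let B' := translate (- inf B) B in
  [/\ spans (diam A) A', spans (diam B) B' & exists A1 B1 S : set R,
    [/\ measurable_version A' A1, measurable_version B' B1, measurable_version (sumset A' B') S
      & critical (diam A) (diam B) A1 B1 S]].
Proof.
move=> bA bB leD sumE sum_lt A' B'; have [A0 B0] := critical_nonempty bB leD sum_lt.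
have [spA spB] := (spans_translate_inf bA A0, spans_translate_inf bB B0); split => //.
apply: critical_version (spans_ge0 spB) leD spA spB _ _;
  by rewrite ?sumset_translate !inner_lebesgue_translate.
Qed.

End Normalization.

Theorem theorem1p3 (R : realType) (A B : set R)
  (hA : bounded_set A) (hB : bounded_set B) (hD : diam B <= diam A)
  (heq : inner_lebesgue (sumset A B) = ((diam B)%:E + inner_lebesgue A)%E)
  (hlt : ((diam B)%:E + inner_lebesgue A
            < inner_lebesgue A + 2%:E * inner_lebesgue B)%E) :
  let DA := diam A in
  let DB := diam B in
  let A' := translate (- inf A) A in
  let B' := translate (- inf B) B in
  let AB := sumset A' B' in
  exists b c : R,
    [/\ (0 <= b <= DB) /\ (0 <= c <= DB),
        (inner_lebesgue B < DB%:E)%E -> 0 < b /\ 0 < c,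
        (inner_lebesgue A + inner_lebesgue B - DB%:E <= (DA - c - b)%:E)%E &
    let I : set R := (`]b, DA - c[)%classic in
    let A1 := A' `&` `[0, b] in
    let A2 := reflect_at DA (A' `&` `[DA - c, DA]) in
    [/\ null_eq (A' `&` `[0, b]) (AB `&` `[0, b]),
        null_eq (AB `&` `[DA + DB - c, DA + DB]) (reflect_at (DA + DB) A2),
        null_sub I A',
        null_sub (`]b, DA + DB - c[)%classic AB &
        null_eq A' (A1 `|` I `|` reflect_at DA A2) /\
        null_eq AB (A1 `|` (`]b, DA + DB - c[)%classic `|` reflect_at (DA + DB) A2)] /\
    exists B1 BI B2 : set R,
    [/\ null_eq B' (B1 `|` BI `|` reflect_at DB B2),
        [/\ B1 `&` BI = set0, B1 `&` reflect_at DB B2 = set0 &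
            BI `&` reflect_at DB B2 = set0],
        [/\ B1 `<=` A1, B2 `<=` A2 & BI `<=` (`]b, DB - c[)%classic],
        (let c1 := left_half_radius DA A' in
         forall x : R, 0 < x <= c1 ->
           (inner_lebesgue (B1 `&` `[0%R, x]) <= (x ^+ 2 / c1)%:E)%E) &
        (let c2 := right_half_radius DA A' in
         forall x : R, 0 < x <= c2 ->
           (inner_lebesgue (B2 `&` `[0%R, x]) <= (x ^+ 2 / c2)%:E)%E)] ].
Proof.
move=> DA DB A' B' AB.
have [spA spB [A1 [B1 [S [vA vB vS cr]]]]] :=
  critical_version_translate_inf hA hB hD heq hlt.
have [b [c [cut bc_gt0]]] := critical_cuts cr.
rewrite -(inner_lebesgue_translate (- inf A) A) -(inner_lebesgue_translate (- inf B) B).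
rewrite (measurable_version_inner vA) (measurable_version_inner vB).
exists b, c; split; [exact: (cuts_in_range cr cut)|by rewrite lte_fin| |].
  by rewrite -!EFinD lee_fin; exact: (cuts_length cr cut).
move=> I A_left A_right.
have -> : reflect_at DA A_right = A' `&` `[DA - c, DA].
  by rewrite reflect_at_reflect_at subrr translate0.
have -> : reflect_at (DA + DB) A_right = translate DB (A' `&` `[DA - c, DA]).
  by rewrite reflect_at_reflect_at addrAC subrr add0r.
have [subA subB] := (spA.1, spB.1).
split; last exact: summand_parts subB vA vB cr cut.
split; [exact: left_parts_null_eq vA vS cr cut|exact: right_parts_null_eq vA vS cr cut| | |split].
- exact: middle_null_sub_summand vA cr cut.
- exact: middle_null_sub_sumset vS cr cut.
- exact: summandA_decomposition subA vA cr cut.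
- exact: sumset_decomposition subA subB vA vS cr cut.
Qed.
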